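(* Let $1\le p\le 2$. 1. Let $1\le q\le 2$, and let $\mu$ be a positive Borel measure on $\mathbb{D}$. Assume that the formal identity $f\in H^p\longmapsto f\in L^q(\mathbb{D},\mu)$ is an $r$-summing operator for some $r\ge1$. Then $$\int_{\mathbb{D}}\frac{1}{(1-|z|)^{q/2}}\,d\mu<\infty.$$ In particular, if $J_\mu\colon H^p\to L^p(\mu)$, $J_\mu f=f$, is an $r$-summing operator for some $r\ge 1$, then $$\int_{\mathbb{D}}\frac{1}{(1-|z|)^{p/2}}\,d\mu<\infty.\qquad( * )$$ 2. When $1\le p<2$, condition $( * )$ is not sufficient in general: there exists a Carleson measure $\mu$ on $\mathbb{D}$ satisfying $( * )$ such that $J_\mu\colon H^p\to L^p(\mu)$ is not $r$-summing for any $r\ge1$.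
   Context: $\mathbb{D}$ is the open unit disk, $\mathbb{T}$ its boundary, $H^p$ the classical Hardy space on $\mathbb{D}$. A positive Borel measure $\mu$ on $\mathbb{D}$ is a Carleson measure if $\sup_{\xi\in\mathbb{T}}\mu(\mathcal{W}(\xi,h))=O(h)$ as $h\to0$, where $\mathcal{W}(\xi,h)=\{z: 1-h\le|z|\le1,\ |\arg(z\bar\xi)|\le h\}$; equivalently $J_\mu\colon H^p\to L^p(\mu)$ is bounded. A bounded operator $T\colon X\to Y$ between Banach spaces is $r$-summing ($1\le r<\infty$) if there is $C\ge 0$ with $\big(\sum_{j}\|Tx_j\|^r\big)^{1/r}\le C\sup_{x^*\in B_{X^*}}\big(\sum_j|\langle x^*,x_j\rangle|^r\big)^{1/r}$ for all finite sequences $(x_j)$ in $X$. *)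

(* Defs.v *)
From mathcomp Require Import all_boot all_order all_algebra.
From mathcomp Require Export complex.
From mathcomp Require Import all_classical all_reals all_analysis.
Set Implicit Arguments.
Unset Strict Implicit.
Unset Printing Implicit Defensive.
Import Order.TTheory GRing.Theory Num.Theory numFieldNormedType.Exports.
Local Open Scope classical_set_scope.
Local Open Scope ring_scope.
Local Open Scope complex_scope.

(* The regular module R[i]^o is the form of the complex field on which the
   library puts the topology given by the modulus and complex derivability. *)
Notation cplx R := (R[i]^o) (only parsing).

(* The modulus with values in R; `|z| has values in R[i]. *)
Notation cabs := Normc.normc.

Definition borelC (R : realType) := g_sigma_algebraType (@open (cplx R)).

Definition disk (R : realType) : set (cplx R) := [set z | cabs z < 1].

Arguments disk : clear implicits.

Definition circle (R : realType) : set (cplx R) := [set z | cabs z = 1].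
Arguments circle : clear implicits.

(* A Borel measure on the disk is represented by its extension by zero. *)
Definition on_disk (R : realType) (mu : {measure set (borelC R) -> \bar R}) :=
  mu (~` disk R) = 0%E.

(* Normed function spaces are given by a carrier X inside a vector space V and
   a norm nX, possibly infinite outside X and possibly vanishing on functions
   identified with 0. Linearity and bounds are only required on X, and a
   functional bounded by nX respects that identification, so [dual_ball] is the
   closed unit ball of the dual of the associated normed space. *)
Section summing.
Context (R : realType) (V W : lmodType R[i]).
Variables (X : set V) (nX : V -> \bar R) (Y : set W) (nY : W -> \bar R).

Definition dual_ball : set (V -> R[i]) :=
  [set phi | (forall (a : R[i]) f g, X f -> X g ->
                phi (a *: f + g) = a * phi f + phi g) /\
             (forall f, X f -> ((cabs (phi f))%:E <= nX f)%E)].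

Definition bounded_operator (T : V -> W) : Prop :=
  [/\ forall (a : R[i]) f g, X f -> X g -> T (a *: f + g) = a *: T f + T g,
      forall f, X f -> Y (T f) &
      exists C : R, forall f, X f -> (nY (T f) <= C%:E * nX f)%E].

Definition summing (r : R) (T : V -> W) : Prop :=
  bounded_operator T /\
  exists2 C : R, 0 <= C &
    forall (n : nat) (x : 'I_n -> V), (forall j, X (x j)) ->
      ((\sum_(j < n) nY (T (x j)) `^ r) `^ r^-1 <=
       C%:E * ereal_sup
         [set ((\sum_(j < n) cabs (phi (x j)) `^ r) `^ r^-1)%:E
         | phi in dual_ball])%E.

End summing.

Section spaces.
Context (R : realType).
Implicit Types (p q : R) (f : cplx R -> cplx R).

Definition hardy_norm p f : \bar R :=
  ereal_sup [set (((2 * pi)^-1%:E * \int[lebesgue_measure]_(t in `[0%R, (2 * pi)%R])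
                     (cabs (f ((r * cos t) +i* (r * sin t))) `^ p)%:E) `^ p^-1)%E
            | r in [set r : R | 0 <= r < 1]].

Definition hardy p : set (cplx R -> cplx R) :=
  [set f | (forall z, disk R z -> derivable f z 1) /\
           (hardy_norm p f < +oo)%E].

Variable mu : {measure set (borelC R) -> \bar R}.

Definition Lq_norm q f : \bar R :=
  'N[mu]_q%:E[(fun z : borelC R => (cabs (f z))%:E) \_ (disk R)]%E.

Definition Lq q : set (cplx R -> cplx R) :=
  [set f | measurable_fun (disk R : set (borelC R)) (f : borelC R -> borelC R) /\
           (Lq_norm q f < +oo)%E].

End spaces.

Definition identity_summing (R : realType) (p q r : R)
    (mu : {measure set (borelC R) -> \bar R}) : Prop :=
  summing (hardy p) (hardy_norm p) (Lq mu q) (Lq_norm mu q) r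
    (fun f : cplx R -> cplx R => f).

(* Principal argument, in ]-pi, pi], of a nonzero complex number. *)
Definition carg (R : realType) (z : R[i]) : R :=
  if 0 <= complex.Im z then acos (complex.Re z / cabs z)
  else - acos (complex.Re z / cabs z).

Definition carleson_window (R : realType) (xi : cplx R) (h : R) :
    set (borelC R) :=
  [set z : cplx R | 1 - h <= cabs z <= 1 /\ `|carg (z * xi^*)| <= h].

Definition carleson (R : realType) (mu : {measure set (borelC R) -> \bar R}) :
    Prop :=
  exists C : R, \forall h \near 0^'+,
    (ereal_sup [set mu (carleson_window xi h) | xi in circle R] <=
     (C * h)%:E)%E.

Definition weight_integral (R : realType) (q : R)
    (mu : {measure set (borelC R) -> \bar R}) : \bar R :=
  (\int[mu]_(z in (disk R : set (borelC R))) (1 / (1 - cabs z) `^ (q / 2))%:E)%E.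

(* Main.v *)
Require Import Defs.
From HB Require Import structures.
From mathcomp Require Import all_boot all_order all_algebra.
From mathcomp Require Import all_classical all_reals all_analysis.
From mathcomp Require Import measurable_realfun ring lra.
Set Implicit Arguments.
Unset Strict Implicit.
Unset Printing Implicit Defensive.
Import Order.TTheory GRing.Theory Num.Theory numFieldNormedType.Exports.
Local Open Scope classical_set_scope.
Local Open Scope complex_scope.
Local Open Scope ring_scope.

(** Both parts rest on one weighted inequality ([weighted_bound]). Suppose that
the identity from H^p to L^q(mu) is r-summing, and let g be holomorphic with
|g| <= 1 on the disk and mean square at most B on circles. Then
  int |g|^q (1 - |z|)^(-q/2) dmu <= K B^((1 - p/2) q/p),
where K depends neither on g nor on B. To see this, apply the summing inequality
to the 2^M functions sum_(i < M) e_i g z^i, for all choices of the signs e_i.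

Seen by a functional phi of the dual ball of H^p, these functions form a
Rademacher sum with coefficients phi(g z^i). The l^2 norm of the coefficients is
dual to the estimate ||g F||_p <= D ||F||_2 for polynomials F, which follows from
Hölder's inequality with D^p = 2 B^(1 - p/2) ([hardy_norm_prod]). So Khinchine's
inequality bounds the right side of the summing inequality by a multiple of D,
for every r ([summing_signs_le]).

On the other side, the triangle inequality in L^q and the lower Khinchine
inequality bound the average of the L^q norms from below by the L^q norm of the
square function |g| (sum_(i < M) |z|^(2i))^(1/2), and letting M grow gives the
weight.

Taking g = 1 and B = 1 yields the necessary condition.

For p < 2, let mu be the image of Lebesgue measure on [0, 1] under a curve
t |-> (1 - t^a) u(t), where u(t) is the unit vector with imaginary part t and
1 < a < 2/p. A Carleson window of size h meets the curve only for parameters in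
an interval of length 2 h, so mu is a Carleson measure. The weight becomes
t^(-b) with b = a p/2 < 1, which is integrable. Now take for g the mean of
1, z, ..., z^(N-1), for which B = 1/N and |g| >= 1/2 on the piece t <= 1/(6N) of
the curve. The left side is at least a constant times N^(b - 1), the right side
is K N^(p/2 - 1), and b > p/2 because a > 1. As N grows this contradicts the
weighted inequality, whatever the value of r. *)

(** * Rademacher sums *)

Section rademacher.
Context (R : realType).
Implicit Types (M : nat).

Notation signs M := {ffun 'I_M -> bool}.

Lemma card_signs M : (#|{: signs M}|%:R : R) = 2 ^+ M.
Proof. by rewrite card_ffun card_bool card_ord natrX. Qed.

Lemma sum_signs_prod M (F : 'I_M -> bool -> R) :
  \sum_(e : signs M) \prod_i F i (e i) = \prod_i (F i true + F i false).
Proof.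
rewrite -(bigA_distr_bigA F).
by apply: eq_bigr => i _; rewrite big_bool.
Qed.

Definition rsum M (a : 'I_M -> R) (e : signs M) : R := \sum_i (-1) ^+ e i * a i.

Lemma sum_signs_expR M (a : 'I_M -> R) :
  \sum_(e : signs M) expR (rsum a e) = \prod_i (expR (- a i) + expR (a i)).
Proof.
pose F (i : 'I_M) (b : bool) := expR ((-1) ^+ b * a i).
transitivity (\sum_(e : signs M) \prod_i F i (e i)).
  by apply: eq_bigr => e _; rewrite /rsum expR_sum.
rewrite sum_signs_prod; apply: eq_bigr => i _.
by rewrite /F expr0 expr1 mul1r mulN1r.
Qed.

(** This is cosh (a / 2) <= exp (a^2 / 2). Since e^x <= 1 / (1 - x) for x < 1,
the sum of the two exponentials is at most 2 / (1 - a^2 / 4). *)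
Lemma expR_add_le (a : R) : a ^+ 2 <= 1 ->
  expR (- (a / 2)) + expR (a / 2) <= 2 * expR (a ^+ 2 / 2).
Proof.
move=> a1.
have h (x : R) : x < 1 -> expR x <= (1 - x)^-1.
  move=> x1; rewrite -[expR x]invrK -expRN lef_pV2 ?posrE ?expR_gt0 ?subr_gt0//.
  exact: expR_ge1Dx.
have [am ap] : -1 <= a /\ a <= 1 by split; nra.
apply: (@le_trans _ _ ((1 + a / 2)^-1 + (1 - a / 2)^-1)).
  apply: lerD; last by apply: h; lra.
  by rewrite -[X in 1 + X]opprK; apply: h; lra.
apply: (@le_trans _ _ (2 * (1 + a ^+ 2 / 2))); last first.
  by rewrite ler_pM2l// expR_ge1Dx.
have -> : (1 + a / 2)^-1 + (1 - a / 2)^-1 = 2 / (1 - a ^+ 2 / 4).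
  field; apply/and3P; split; apply/eqP; nra.
rewrite ler_pM2l// -[_^-1]mul1r ler_pdivrMr; nra.
Qed.

(** From s <= e^s at s = t / (2 r); the factor 1/2 in the exponent keeps the
arguments of the hyperbolic cosines small enough for [expR_add_le]. *)
Lemma powR_le_expR (r t : R) : 0 < r -> 0 <= t ->
  t `^ r <= (2 * r) `^ r * expR (t / 2).
Proof.
move=> r0 t0.
have -> : expR (t / 2) = expR (t / (2 * r)) `^ r.
  by rewrite -expRM; congr expR; field; rewrite gt_eqF.
rewrite -powRM ?expR_ge0//; last by rewrite mulr_ge0// ltW.
have r20 : 0 <= 2 * r by rewrite mulr_ge0// ltW.
rewrite ge0_ler_powR ?nnegrE ?mulr_ge0 ?expR_ge0 ?(ltW r0)//.
rewrite mulrC -ler_pdivrMr ?mulr_gt0//.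
by apply: le_trans (expR_ge1Dx _); rewrite lerDr.
Qed.

(** Summed over all signs, the exponential of a Rademacher sum is a product of
hyperbolic cosines. Normalised coefficients bound this product by 2 per choice
of signs, and the exponential dominates every moment. *)
Lemma rsum_moment_le M (a : 'I_M -> R) (r : R) : 0 < r ->
  \sum_i a i ^+ 2 <= 1 ->
  \sum_(e : signs M) `|rsum a e| `^ r <= 2 ^+ M * (4 * (2 * r) `^ r).
Proof.
move=> r0 a1.
have ai1 i : a i ^+ 2 <= 1.
  apply: le_trans a1; rewrite (bigD1 i)//= lerDl.
  by apply: sumr_ge0 => j _; rewrite sqr_ge0.
have E (b : 'I_M -> R) : (forall i, b i ^+ 2 = a i ^+ 2) ->
    \sum_(e : signs M) expR (rsum b e / 2) <= 2 ^+ M * 2.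
  move=> ba.
  have -> : \sum_(e : signs M) expR (rsum b e / 2) =
            \sum_(e : signs M) expR (rsum (fun i => b i / 2) e).
    apply: eq_bigr => e _; congr expR.
    by rewrite /rsum mulr_suml; apply: eq_bigr => i _; rewrite mulrA.
  rewrite sum_signs_expR.
  apply: (@le_trans _ _ (\prod_(i < M) (2 * expR (a i ^+ 2 / 2)))).
    apply: ler_prod => i _; rewrite addr_ge0 ?expR_ge0//= -ba.
    by apply: expR_add_le; rewrite ba.
  rewrite big_split/= prodr_const card_ord -expR_sum ler_pM2l ?exprn_gt0//.
  rewrite -mulr_suml.
  apply: (@le_trans _ _ (expR (2^-1))).
    by rewrite ler_expR ler_pdivrMr// mulVf.
  rewrite -[expR _]invrK -expRN -[leRHS]invrK lef_pV2 ?posrE ?invr_gt0 ?expR_gt0//.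
  by apply: le_trans (expR_ge1Dx _); lra.
apply: (@le_trans _ _ (\sum_(e : signs M) (2 * r) `^ r *
    (expR (rsum a e / 2) + expR (rsum (fun i => - a i) e / 2)))).
  apply: ler_sum => e _; apply: le_trans (powR_le_expR r0 (normr_ge0 _)) _.
  rewrite ler_wpM2l ?powR_ge0//.
  have -> : rsum (fun i => - a i) e = - rsum a e.
    by rewrite /rsum -sumrN; apply: eq_bigr => i _; rewrite mulrN.
  by case: ger0P => _; rewrite ?lerDl ?lerDr expR_ge0.
rewrite -mulr_sumr big_split/=.
apply: (@le_trans _ _ ((2 * r) `^ r * (2 ^+ M * 2 + 2 ^+ M * 2))).
  rewrite ler_wpM2l ?powR_ge0// lerD ?E// => i; exact: sqrrN.
rewrite le_eqVlt; apply/orP; left; apply/eqP; ring.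
Qed.

Lemma rsum_sqr M (a : 'I_M -> R) :
  \sum_(e : signs M) rsum a e ^+ 2 = 2 ^+ M * \sum_i a i ^+ 2.
Proof.
(* Distinct signs are uncorrelated: the sum over all choices factors through
   the coordinates, and the factor of index i vanishes. *)
have orth (i j : 'I_M) : \sum_(e : signs M) (-1) ^+ e i * (-1) ^+ e j
    = if i == j then 2 ^+ M else 0 :> R.
  have [->|ij] := eqVneq i j.
    under eq_bigr do rewrite -expr2 sqrr_sign.
    by rewrite sumr_const -card_signs.
  pose F (k : 'I_M) (b : bool) : R :=
    (if k == i then (-1) ^+ b else 1) * (if k == j then (-1) ^+ b else 1).
  transitivity (\sum_(e : signs M) \prod_k F k (e k)).
    apply: eq_bigr => e _.
    by rewrite big_split/= -!big_mkcond !big_pred1_eq.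
  rewrite sum_signs_prod (bigD1 i)//= /F eqxx (negbTE ij) !mulr1 expr1 expr0.
  by rewrite addNr mul0r.
transitivity (\sum_(e : signs M) \sum_i \sum_j
    ((-1) ^+ e i * (-1) ^+ e j) * (a i * a j)).
  apply: eq_bigr => e _; rewrite /rsum expr2 mulr_suml.
  apply: eq_bigr => i _; rewrite mulr_sumr.
  by apply: eq_bigr => j _; rewrite mulrACA.
rewrite exchange_big/= mulr_sumr; apply: eq_bigr => i _.
rewrite exchange_big/= (bigD1 i)//= [X in _ + X]big1 => [|j ji].
  by rewrite -mulr_suml orth eqxx addr0 -expr2.
by rewrite -mulr_suml orth eq_sym (negbTE ji) mul0r.
Qed.

End rademacher.

(** * Moduli of complex numbers and the Khinchine inequalities *)

Section modulus.
Context (R : realType).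
Implicit Types (z w : R[i]).

Lemma cabs_ge0 z : 0 <= cabs z.
Proof. by case: z => a b; exact: sqrtr_ge0. Qed.

Lemma cabs_sqr z : cabs z ^+ 2 = complex.Re z ^+ 2 + complex.Im z ^+ 2.
Proof. by case: z => a b /=; rewrite sqr_sqrtr// addr_ge0 ?sqr_ge0. Qed.

Lemma norm_cabs z : `|z| = (cabs z)%:C.
Proof. by rewrite normc_def; case: z. Qed.

Lemma cabs_le_ReIm z : cabs z <= `|complex.Re z| + `|complex.Im z|.
Proof.
rewrite -(ler_pXn2r (n := 2)) ?nnegrE ?cabs_ge0 ?addr_ge0//.
rewrite cabs_sqr sqrrD !real_normK ?num_real// addrAC lerDl.
by rewrite mulrn_wge0// mulr_ge0.
Qed.

Lemma cabsM z w : cabs (z * w) = cabs z * cabs w.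
Proof. exact: Normc.normcM. Qed.

Lemma cabsD z w : cabs (z + w) <= cabs z + cabs w.
Proof. exact: le_normcD. Qed.

Lemma cabsX z n : cabs (z ^+ n) = cabs z ^+ n.
Proof.
by elim: n => [|n IH]; rewrite ?expr0 ?Normc.normc1// !exprS cabsM IH.
Qed.

Lemma cabs_sum (I : Type) (s : seq I) (P : pred I) (F : I -> R[i]) :
  cabs (\sum_(i <- s | P i) F i) <= \sum_(i <- s | P i) cabs (F i).
Proof.
elim/big_rec2: _ => [|i x y _ h]; first by rewrite Normc.normc0.
by apply: le_trans (cabsD _ _) _; rewrite lerD2l.
Qed.

Lemma cabs_real (x : R) : cabs x%:C = `|x|.
Proof. by rewrite /= expr0n/= addr0 sqrtr_sqr. Qed.

Lemma cabsJ z : cabs z^* = cabs z.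
Proof. by case: z => a b /=; rewrite sqrrN. Qed.

Lemma mulcJ z : z * z^* = (cabs z ^+ 2)%:C.
Proof. by rewrite cabs_sqr; case: z => a b; simpc; congr (_ +i* _); ring. Qed.

End modulus.

Section khinchine.
Context (R : realType).
Implicit Types (M : nat).

Notation signs M := {ffun 'I_M -> bool}.

Lemma Re_sign_sum M (c : 'I_M -> R[i]) (e : signs M) :
  complex.Re (\sum_i (-1) ^+ e i * c i) = rsum (fun i => complex.Re (c i)) e.
Proof.
rewrite /rsum; elim/big_rec2: _ => [//|i x y _ <-].
by case: y (c i) (e i) => [a b] [u v] []; rewrite ?expr0 ?expr1; simpc.
Qed.

Lemma Im_sign_sum M (c : 'I_M -> R[i]) (e : signs M) :
  complex.Im (\sum_i (-1) ^+ e i * c i) = rsum (fun i => complex.Im (c i)) e.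
Proof.
rewrite /rsum; elim/big_rec2: _ => [//|i x y _ <-].
by case: y (c i) (e i) => [a b] [u v] []; rewrite ?expr0 ?expr1; simpc.
Qed.

Definition khinchine_const (r : R) := 2 `^ r * (8 * (2 * r) `^ r).

Lemma khinchine_const_gt0 r : 0 < r -> 0 < khinchine_const r.
Proof. by move=> r0; rewrite !mulr_gt0 ?powR_gt0// mulr_gt0. Qed.

(** The real and imaginary parts, divided by [A], are real Rademacher sums with
coefficients in the unit ball of l^2. *)
Lemma khinchine_upper M (c : 'I_M -> R[i]) (r A : R) : 0 < r -> 0 < A ->
  \sum_i cabs (c i) ^+ 2 <= A ^+ 2 ->
  \sum_(e : signs M) cabs (\sum_i (-1) ^+ e i * c i) `^ r
    <= 2 ^+ M * (khinchine_const r * A `^ r).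
Proof.
move=> r0 A0 cA.
pose a i := complex.Re (c i) / A; pose b i := complex.Im (c i) / A.
have ab1 : \sum_i a i ^+ 2 + \sum_i b i ^+ 2 <= 1.
  rewrite -big_split/=.
  have -> : \sum_i (a i ^+ 2 + b i ^+ 2) = (\sum_i cabs (c i) ^+ 2) / A ^+ 2.
    rewrite mulr_suml; apply: eq_bigr => i _.
    by rewrite cabs_sqr /a /b !expr_div_n mulrDl.
  by rewrite ler_pdivrMr ?exprn_gt0// mul1r.
have [a0 b0] : 0 <= \sum_i a i ^+ 2 /\ 0 <= \sum_i b i ^+ 2.
  by split; apply: sumr_ge0 => i _; rewrite sqr_ge0.
have ha := rsum_moment_le r0 (_ : \sum_i a i ^+ 2 <= 1).
have hb := rsum_moment_le r0 (_ : \sum_i b i ^+ 2 <= 1).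
apply: (@le_trans _ _ (\sum_(e : signs M)
    (A `^ r * 2 `^ r * (`|rsum a e| `^ r + `|rsum b e| `^ r)))).
  apply: ler_sum => e _.
  have hD (x y : R) : 0 <= x -> 0 <= y ->
      (x + y) `^ r <= 2 `^ r * (x `^ r + y `^ r).
    move=> x0 y0; wlog xy : x y x0 y0 / x <= y.
      by move=> W; case: (leP x y) => [|/ltW] h; [|rewrite addrC [x `^ r + _]addrC]; exact: W.
    apply: (@le_trans _ _ ((2 * y) `^ r)).
      by rewrite ge0_ler_powR ?nnegrE ?mulr_ge0 ?addr_ge0 ?(ltW r0)//; lra.
    by rewrite powRM// ler_wpM2l ?powR_ge0// lerDr powR_ge0.
  rewrite -mulrA; apply: (@le_trans _ _ (A `^ r * (`|rsum a e| + `|rsum b e|) `^ r)); last first.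
    by rewrite ler_wpM2l ?powR_ge0// hD.
  rewrite -powRM ?addr_ge0 ?(ltW A0)//.
  rewrite ge0_ler_powR ?nnegrE ?mulr_ge0 ?addr_ge0 ?cabs_ge0 ?(ltW r0) ?(ltW A0)//.
  apply: le_trans (cabs_le_ReIm _) _.
  rewrite Re_sign_sum Im_sign_sum.
  have E (u : 'I_M -> R) : rsum u e = A * rsum (fun i => u i / A) e.
    rewrite /rsum mulr_sumr; apply: eq_bigr => i _; field.
    by rewrite gt_eqF.
  rewrite [rsum (fun i => complex.Re _) e]E [rsum (fun i => complex.Im _) e]E.
  by rewrite !normrM (gtr0_norm A0) mulrDr.
rewrite -mulr_sumr big_split/=.
apply: (@le_trans _ _ (A `^ r * 2 `^ r *
    (2 ^+ M * (4 * (2 * r) `^ r) + 2 ^+ M * (4 * (2 * r) `^ r)))).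
  by rewrite ler_wpM2l ?mulr_ge0 ?powR_ge0// lerD ?ha ?hb//; lra.
rewrite le_eqVlt /khinchine_const; apply/orP; left; apply/eqP; ring.
Qed.

Lemma sign_sum_sqr M (c : 'I_M -> R[i]) :
  \sum_(e : signs M) cabs (\sum_i (-1) ^+ e i * c i) ^+ 2
    = 2 ^+ M * \sum_i cabs (c i) ^+ 2.
Proof.
under eq_bigr do rewrite cabs_sqr Re_sign_sum Im_sign_sum.
rewrite big_split/= !rsum_sqr -mulrDr -big_split/=; congr (_ * _).
by apply: eq_bigr => i _; rewrite cabs_sqr.
Qed.

Definition khinchine_lower_const : R := ((1 + khinchine_const 4) * 2)^-1.

Lemma khinchine_lower_const_gt0 : 0 < khinchine_lower_const.
Proof.
by rewrite invr_gt0 mulr_gt0// addr_gt0// khinchine_const_gt0.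
Qed.

(** The second and fourth moments control the first one through the inequality
t >= l t^2 - l^3 t^4 / 4, valid for all t >= 0, summed over all signs. *)
Lemma khinchine_lower M (c : 'I_M -> R[i]) :
  khinchine_lower_const * 2 ^+ M * Num.sqrt (\sum_i cabs (c i) ^+ 2)
    <= \sum_(e : signs M) cabs (\sum_i (-1) ^+ e i * c i).
Proof.
set A := Num.sqrt _.
have s0 : 0 <= \sum_i cabs (c i) ^+ 2.
  by apply: sumr_ge0 => i _; rewrite sqr_ge0.
have AE : A ^+ 2 = \sum_i cabs (c i) ^+ 2 by rewrite sqr_sqrtr.
have : 0 <= A by exact: sqrtr_ge0.
rewrite le_eqVlt => /predU1P[<-|A0].
  by rewrite mulr0; apply: sumr_ge0 => e _; exact: cabs_ge0.
have hK := khinchine_upper (ltr0Sn R 3) A0 (_ : _ <= A ^+ 2).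
have {hK} := hK _ c; rewrite AE lexx => /(_ isT).
rewrite (powR_mulrn 4 (ltW A0)).
under eq_bigr do rewrite (powR_mulrn 4 (cabs_ge0 _)).
have := sign_sum_sqr c; rewrite -AE.
have K0 : 0 < khinchine_const (4 : R) by exact: khinchine_const_gt0.
rewrite /khinchine_lower_const.
set K := khinchine_const _ in K0 *.
set S2 := \sum_e _ ^+ 2; set S4 := \sum_e _ ^+ 4; set S1 := \sum_e _.
move=> hS2 hS4.
(* With t of order A, this l makes the quartic term a small fraction of the
   quadratic one. *)
pose l : R := (1 + K)^-1 / A.
have l0 : 0 < l by rewrite divr_gt0// invr_gt0; lra.
have h : l * S2 - l ^+ 3 / 4 * S4 <= S1.
  rewrite /S2 /S4 /S1 !mulr_sumr -sumrB; apply: ler_sum => e _.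
  set t := cabs _; have t0 : 0 <= t by exact: cabs_ge0.
  have : l * t - (l * t) ^+ 3 / 4 <= 1.
    have : 0 <= l * t by rewrite mulr_ge0// ltW.
    move: (l * t) => s s0'.
    (* The double root 6/5 is close to the minimiser 2 / sqrt 3. *)
    have : 0 <= (s - 6 / 5) ^+ 2 * (s + 12 / 5) by rewrite mulr_ge0 ?sqr_ge0//; lra.
    rewrite -subr_ge0 => h; rewrite -subr_ge0.
    have -> : 1 - (s - s ^+ 3 / 4) =
      ((s - 6 / 5) ^+ 2 * (s + 12 / 5) - 0) / 4 + 2 / 25 * s + 17 / 125 by field.
    by rewrite !addr_ge0// ?divr_ge0// mulr_ge0.
  move/(ler_wpM2r t0); rewrite mul1r; apply: le_trans.
  rewrite le_eqVlt; apply/orP; left; apply/eqP; ring.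
apply: le_trans h; rewrite hS2.
apply: (@le_trans _ _ (l * (2 ^+ M * A ^+ 2) - l ^+ 3 / 4 * (2 ^+ M * (K * A ^+ 4)))); last first.
  by rewrite lerD2l lerN2 ler_wpM2l// divr_ge0// exprn_ge0// ltW.
have -> : l * (2 ^+ M * A ^+ 2) - l ^+ 3 / 4 * (2 ^+ M * (K * A ^+ 4)) =
    2 ^+ M * A * ((1 + K)^-1 * (1 - (1 + K)^-1 ^+ 2 * K / 4)).
  rewrite /l; field; rewrite !gt_eqF//; lra.
rewrite invfM -mulrA mulrC ler_wpM2l ?mulr_ge0 ?exprn_ge0 ?(ltW A0)//.
rewrite ler_wpM2l ?invr_ge0//; first lra.
have : (1 + K)^-1 ^+ 2 * K <= 1; last by lra.
rewrite exprVn mulrC ler_pdivrMr ?exprn_gt0; nra.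
Qed.

End khinchine.

(** * Summing operators and random signs *)

Section summing_signs.
Context (R : realType) (V W : lmodType R[i]).
Context (X : set V) (nX : V -> \bar R) (Y : set W) (nY : W -> \bar R).

Notation signs M := {ffun 'I_M -> bool}.

(** Functionals are linear on [X] only, so every partial sum has to be exhibited
in [X], as a combination of the whole family. *)
Lemma dual_ball_sum M (f : 'I_M -> V) (phi : V -> R[i]) (a : 'I_M -> R[i]) :
  (forall b : 'I_M -> R[i], X (\sum_i b i *: f i)) ->
  dual_ball X nX phi -> phi (\sum_i a i *: f i) = \sum_i a i * phi (f i).
Proof.
move=> Xf [lin _].
have Xi i : X (f i).
  have := Xf (fun j => (j == i)%:R); rewrite (bigD1 i)//= eqxx scale1r.
  by rewrite big1 ?addr0// => j /negbTE ->; rewrite scale0r.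
have X0 : X 0.
  by have := Xf (fun=> 0); rewrite big1 // => i _; exact: scale0r.
have phi0 : phi 0 = 0.
  have := lin 1 _ _ X0 X0; rewrite scaler0 addr0 mul1r => /eqP.
  by rewrite -subr_eq0 opprD addrA subrr sub0r oppr_eq0 => /eqP.
suff H s : (exists b : 'I_M -> R[i], \sum_(i <- s) a i *: f i = \sum_i b i *: f i) /\
    phi (\sum_(i <- s) a i *: f i) = \sum_(i <- s) a i * phi (f i).
  by have [_ ->] := H (index_enum _).
elim: s => [|i s [[b E] IH]].
  rewrite !big_nil; split => //; exists (fun=> 0).
  by rewrite big1// => i _; rewrite scale0r.
rewrite !big_cons; split; last by rewrite lin ?IH// E; exact: Xf.
exists (fun j => a i * (j == i)%:R + b j); rewrite E.
under [RHS]eq_bigr do rewrite scalerDl.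
rewrite big_split/=; congr (_ + _).
rewrite (bigD1 i)//= eqxx mulr1 big1 ?addr0// => j /negbTE ->.
by rewrite mulr0 scale0r.
Qed.

(** Test the functional on the combination of the [f i] whose coefficients are
the conjugates of its own values: this combination is sent to the square sum of
the values, and its norm is at most [D] times the square root of that sum. *)
Lemma dual_ball_l2 M (f : 'I_M -> V) (D : R) (phi : V -> R[i]) : 0 <= D ->
  (forall b : 'I_M -> R[i], X (\sum_i b i *: f i)) ->
  (forall b : 'I_M -> R[i], (nX (\sum_i b i *: f i)%R <=
     (D * Num.sqrt (\sum_i cabs (b i) ^+ 2))%:E)%E) ->
  dual_ball X nX phi -> \sum_i cabs (phi (f i)) ^+ 2 <= D ^+ 2.
Proof.
move=> D0 Xf nf dphi; pose b i := (phi (f i))^*.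
have := dual_ball_sum b Xf dphi.
set S := \sum_i cabs (phi (f i)) ^+ 2.
have -> : \sum_i b i * phi (f i) = S%:C.
  by rewrite /S rmorph_sum/=; apply: eq_bigr => i _; rewrite mulrC mulcJ.
move=> phiS; have [_ /(_ _ (Xf b))] := dphi.
rewrite phiS cabs_real => /le_trans/(_ (nf b)); rewrite lee_fin.
have -> : \sum_i cabs (b i) ^+ 2 = S.
  by apply: eq_bigr => i _; rewrite cabsJ.
have S0 : 0 <= S by apply: sumr_ge0 => i _; rewrite sqr_ge0.
rewrite ger0_norm// => h.
have [/le_trans/(_ (sqr_ge0 D))//|S1] := leP S 0.
have s0 : 0 < Num.sqrt S by rewrite sqrtr_gt0.
have : Num.sqrt S <= D.
  by rewrite -(ler_pM2r s0) -expr2 sqr_sqrtr.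
by move=> /(lerXn2r 2); rewrite !nnegrE sqr_sqrtr//; apply => //; exact: ltW.
Qed.

Context (nY0 : forall g, (0 <= nY g)%E).

(** The summing inequality for the 2^M signed sums of the [f i]. A functional in
the dual ball turns them into a Rademacher sum with coefficients of l^2 norm at
most [D], whose r-th moments are bounded by Khinchine's inequality. The constant
does not depend on the number of vectors. *)
Lemma summing_signs_le (r : R) (T : V -> W) : 1 <= r ->
  summing X nX Y nY r T ->
  exists2 B : R, 0 < B & forall M (f : 'I_M -> V) (D : R), 0 < D ->
    (forall b : 'I_M -> R[i], X (\sum_i b i *: f i)) ->
    (forall b : 'I_M -> R[i], (nX (\sum_i b i *: f i)%R <=
       (D * Num.sqrt (\sum_i cabs (b i) ^+ 2))%:E)%E) ->
    (\sum_(e : signs M) nY (T (\sum_i ((-1) ^+ e i : R[i]) *: f i)%R) <=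
       (2 ^+ M * (B * D))%:E)%E.
Proof.
move=> r1 [_ [C C0 hC]].
have r0 : 0 < r by lra.
have [K K0 KE] : exists2 K, 0 < K & K = khinchine_const r.
  by exists (khinchine_const r); first exact: khinchine_const_gt0.
pose B := (C + 1) * K `^ r^-1.
have B0 : 0 < B by rewrite mulr_gt0 ?powR_gt0//; lra.
exists (2 * B) => [|M f D D0 Xf nf]; first by rewrite mulr_gt0.
pose x (e : signs M) := \sum_i ((-1) ^+ e i : R[i]) *: f i.
have := hC _ (fun j : 'I_#|{: signs M}| => x (enum_val j)) (fun j => Xf _).
set s := ereal_sup _.
have sle : (s <= ((2 ^+ M * (K * D `^ r)) `^ r^-1)%:E)%E.
  apply: ge_ereal_sup => _ [phi dphi <-]; rewrite lee_fin.
  rewrite ge0_ler_powR ?nnegrE ?invr_ge0 ?(ltW r0)//.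
  - by apply: sumr_ge0 => j _; exact: powR_ge0.
  - by rewrite !mulr_ge0 ?exprn_ge0 ?powR_ge0 ?(ltW K0).
  rewrite -(big_enum_val (fun e => cabs (phi (x e)) `^ r))/=.
  rewrite (eq_bigr (fun e : signs M => cabs (\sum_i (-1) ^+ e i * phi (f i)) `^ r)).
    rewrite KE; exact: khinchine_upper r0 D0 (dual_ball_l2 (ltW D0) Xf nf dphi).
  by move=> e _; rewrite (dual_ball_sum _ Xf dphi).
rewrite -(big_enum_val (fun e => (nY (T (x e)) `^ r)%E))/=.
have [H H0 HE] : exists2 H, 0 < H & H = B * D.
  by exists (B * D); first exact: mulr_gt0.
move=> hle.
have {hle sle} : (\sum_(e : signs M) nY (T (x e)) `^ r <= (2 ^+ M * H `^ r)%:E)%E.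
  have : ((\sum_(e : signs M) nY (T (x e)) `^ r) `^ r^-1 <=
          ((2 ^+ M * H `^ r) `^ r^-1)%:E)%E.
    apply: le_trans hle _; apply: le_trans (lee_wpmul2l _ sle) _.
      by rewrite lee_fin.
    rewrite -EFinM lee_fin !powRM ?mulr_ge0 ?powR_ge0 ?exprn_ge0 ?(ltW K0) ?(ltW H0)//.
    rewrite -!powRrM mulfV ?gt_eqF// !powRr1 ?(ltW D0) ?(ltW H0)//.
    rewrite HE /B -subr_ge0.
    set u := (2 ^+ M) `^ _; set k := K `^ _.
    have -> : u * ((C + 1) * k * D) - C * (u * (k * D)) = u * k * D by ring.
    by rewrite !mulr_ge0 ?powR_ge0// ltW.
  have S0 : (0 <= \sum_(e : signs M) nY (T (x e)) `^ r)%E.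
    by apply: sume_ge0 => e _; exact: poweR_ge0.
  move=> /(gt0_ler_poweR (ltW r0)); rewrite !in_itv/= !leey !andbT.
  rewrite poweR_ge0 lee_fin powR_ge0 => /(_ isT isT).
  have r_neq0 : r != 0 by rewrite gt_eqF.
  rewrite -poweRrM mulVf// poweRe1// -powRrM mulVf//.
  by rewrite powRr1// mulr_ge0 ?exprn_ge0 ?powR_ge0.
move=> hle.
have yfin e : nY (T (x e)) \is a fin_num.
  rewrite ge0_fin_numE//; apply: (@lty_poweRy _ _ r); first by rewrite gt_eqF.
  apply: (@le_lt_trans _ _ (2 ^+ M * H `^ r)%:E); last exact: ltry.
  apply: le_trans hle; rewrite (bigD1 e)//= leeDl// sume_ge0// => i _.
  exact: poweR_ge0.
pose y e := fine (nY (T (x e))).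
have yE e : nY (T (x e)) = (y e)%:E by rewrite fineK.
have y0 e : 0 <= y e by rewrite fine_ge0.
move: hle; rewrite (eq_bigr (fun e => (y e `^ r)%:E)) => [|e _]; last first.
  by rewrite yE.
rewrite sumEFin lee_fin => hle.
rewrite (eq_bigr (fun e => (y e)%:E)) => [|e _]; last by rewrite -yE.
rewrite sumEFin lee_fin.
(* From power sums to sums: b <= 1 + b^r for b >= 0 replaces the convexity of
   the r-th power at the cost of a factor 2. *)
have : \sum_e y e / H <= \sum_(e : signs M) (1 + y e `^ r / H `^ r).
  apply: ler_sum => e _.
  have b0 : 0 <= y e / H by rewrite divr_ge0// ltW.
  have -> : y e `^ r / H `^ r = (y e / H) `^ r.
    rewrite powRM ?invr_ge0 ?(ltW H0)// -(powR_inv1 (ltW H0)).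
    by rewrite -(powR_inv1 (powR_ge0 H r)) powRAC.
  have [b1|/ltW b1] := leP (y e / H) 1.
    by apply: le_trans b1 _; rewrite lerDl powR_ge0.
  by apply: le_trans (le1r_powR b1 r1) _; rewrite lerDr.
rewrite big_split/= sumr_const card_signs -!mulr_suml ler_pdivrMr//.
move=> /le_trans; apply.
apply: (@le_trans _ _ ((2 ^+ M + 2 ^+ M) * H)).
  rewrite ler_wpM2r ?(ltW H0)// lerD2l ler_pdivrMr ?powR_gt0//.
rewrite HE le_eqVlt; apply/orP; left; apply/eqP; ring.
Qed.

End summing_signs.

(** * Polynomials on circles *)

Section power_sums.
Context (K : numFieldType).

(** A polynomial, given by a sequence of coefficients so that removing its
constant term and dividing by z is a shift of the sequence. *)
Definition psum (n : nat) (c : nat -> K) (z : K) : K := \sum_(i < n) c i * z ^+ i.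

Lemma derivable_monomial (c : K) (n : nat) (z : K^o) :
  derivable (fun z : K^o => c * z ^+ n : K^o) z 1.
Proof.
rewrite (_ : (fun _ => _) = cst c * (id : K -> K) ^+ n); last first.
  by apply/funext => w; rewrite !fctE.
apply: derivableM; first exact: derivable_cst.
exact: derivableX.
Qed.

Lemma derivable_psum n (c : nat -> K) (z : K^o) :
  derivable (psum n c : K^o -> K^o) z 1.
Proof.
elim: n => [|n IH].
  rewrite (_ : psum 0 c = cst 0); first exact: derivable_cst.
  by apply/funext => w; rewrite /psum big_ord0.
rewrite (_ : psum n.+1 c = psum n c + (fun w => c n * w ^+ n)).
  by apply: derivableD; [exact: IH|exact: derivable_monomial].
by apply/funext => w; rewrite /psum big_ord_recr.
Qed.

Lemma derivable_prod (f g : K^o -> K^o) (z : K^o) :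
  derivable f z 1 -> derivable g z 1 -> derivable (fun z => f z * g z : K^o) z 1.
Proof. exact: derivableM. Qed.

Lemma derivable_continuous_at (f : K^o -> K^o) (z : K^o) :
  derivable f z 1 -> {for z, continuous f}.
Proof. by move=> h; apply/differentiable_continuous/derivable1_diffP. Qed.

End power_sums.

Section complex_topology.
Context (R : realType).
Implicit Types (z w : cplx R).

Lemma gt0_complexP (e : R[i]) : 0 < e -> exists2 e' : R, 0 < e' & e = e'%:C.
Proof.
case: e => a b; rewrite ltcE /= => /andP[/eqP -> a0].
by exists a.
Qed.

Lemma cabs_distr z w : `|cabs z - cabs w| <= cabs (z - w).
Proof.
rewrite ler_norml; apply/andP; split.
  rewrite lerNl opprB lerBlDr.
  have -> : cabs (z - w) = cabs (w - z) by rewrite -normcN opprB.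
  by apply: le_trans (cabsD _ _); rewrite subrK.
by rewrite lerBlDr; apply: le_trans (cabsD _ _); rewrite subrK.
Qed.

Lemma Re_le_cabs (z : R[i]) : `|complex.Re z| <= cabs z.
Proof.
rewrite -(ler_pXn2r (n := 2)) ?nnegrE ?cabs_ge0//.
by rewrite cabs_sqr real_normK ?num_real// lerDl sqr_ge0.
Qed.

Lemma continuous_complex (x y : R -> R) (t : R) :
  {for t, continuous x} -> {for t, continuous y} ->
  {for t, continuous (fun s => x s +i* y s : cplx R)}.
Proof.
move=> cx cy; apply/cvgrPdist_lt => e /gt0_complexP[e' e0 ->].
have e2 : 0 < e' / 2 by rewrite divr_gt0.
have hx := @cvgr_dist_lt _ _ _ (nbhs t) _ x (x t) cx _ e2.
have hy := @cvgr_dist_lt _ _ _ (nbhs t) _ y (y t) cy _ e2.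
near=> s; rewrite [ltLHS]norm_cabs ltcR.
apply: le_lt_trans (cabs_le_ReIm _) _ => /=.
rewrite [e']splitr ltrD//; first by near: s; exact: hx.
by near: s; exact: hy.
Unshelve. all: by end_near. Qed.

Lemma near_cabs z (e : R) : 0 < e -> \forall w \near z, cabs (z - w) < e.
Proof.
move=> e0; have e0' : 0 < e%:C by rewrite ltcR.
have h : nbhs z (ball z e%:C) by exact: nbhsx_ballx.
have F : Filter (nbhs z) by exact: nbhs_filter.
apply: (@filterS _ (nbhs z) F _ _ _ h) => w.
by rewrite -ball_normE /ball_/= norm_cabs ltcR.
Qed.

Lemma continuous_cabs : continuous (@Normc.normc R : cplx R -> R).
Proof.
move=> z.
have F : Filter (nbhs z) by exact: nbhs_filter.
apply/(@cvgrPdist_lt _ _ _ (nbhs z) F) => e e0.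
apply: (@filterS _ (nbhs z) F _ _ _ (near_cabs z e0)) => w.
exact/le_lt_trans/cabs_distr.
Qed.

Lemma continuous_Re : continuous (@complex.Re R : cplx R -> R).
Proof.
move=> z.
have F : Filter (nbhs z) by exact: nbhs_filter.
apply/(@cvgrPdist_lt _ _ _ (nbhs z) F) => e e0.
apply: (@filterS _ (nbhs z) F _ _ _ (near_cabs z e0)) => w.
apply: le_lt_trans; apply: le_trans (Re_le_cabs _).
by move: z w {F} => [a b] [c d].
Qed.

End complex_topology.

Section circle_means.
Context (R : realType).

Definition circle_pt (r t : R) : cplx R := (r * cos t) +i* (r * sin t).

Lemma circle_ptX (r t : R) n :
  circle_pt r t ^+ n = (r ^+ n * cos (n%:R * t)) +i* (r ^+ n * sin (n%:R * t)).
Proof.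
elim: n => [|n IH]; first by rewrite !expr0 mul0r cos0 sin0 mulr1 mulr0.
rewrite exprS IH -natr1 mulrDl mul1r cosD sinD exprS.
by rewrite /circle_pt; simpc; congr (_ +i* _); ring.
Qed.

Lemma continuous_circle_pt (r : R) : continuous (circle_pt r).
Proof.
move=> t.
apply: (@continuous_complex _ (fun t => r * cos t) (fun t => r * sin t)).
  by apply: cvgM; [exact: cvg_cst|exact: continuous_cos].
by apply: cvgM; [exact: cvg_cst|exact: continuous_sin].
Qed.

Lemma cabs_circle_pt (r t : R) : 0 <= r -> cabs (circle_pt r t) = r.
Proof.
move=> r0; rewrite /= !exprMn -mulrDr cos2Dsin2 mulr1 sqrtr_sqr.
exact: ger0_norm.
Qed.

Lemma integrable_circle (f : R -> R) : continuous f ->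
  lebesgue_measure.-integrable `[0, 2 * pi] (EFin \o f).
Proof.
move=> cf; apply: continuous_compact_integrable; first exact: segment_compact.
exact: continuous_subspaceT.
Qed.

(** The integrand has an antiderivative of period 2 pi. *)
Lemma integral_circle_monomial (r : R) (d : R[i]) n :
  (\int[lebesgue_measure]_(t in `[0%R, (2 * pi)%R])
     (complex.Re (d * circle_pt r t ^+ n.+1))%:E = 0)%E.
Proof.
pose k : R := n.+1%:R; have k0 : k != 0 by rewrite pnatr_eq0.
pose a := r ^+ n.+1 * complex.Re d; pose b := r ^+ n.+1 * complex.Im d.
pose f (t : R) := a * cos (k * t) - b * sin (k * t).
pose F (t : R) := k^-1 * (a * sin (k * t) + b * cos (k * t)).
have dF (t : R) : is_derive t 1 F (f t).
  apply: is_derive_eq; rewrite /f /GRing.scale/=.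
  by field.
have cf : continuous f.
  move=> t; apply: cvgB; apply: cvgM; try exact: cvg_cst.
    apply: continuous_comp; last exact: continuous_cos.
    by apply: cvgM; [exact: cvg_cst|exact: cvg_id].
  apply: continuous_comp; last exact: continuous_sin.
  by apply: cvgM; [exact: cvg_cst|exact: cvg_id].
have cF : continuous F.
  by move=> t; apply/differentiable_continuous/derivable1_diffP.
transitivity (\int[lebesgue_measure]_(t in `[0%R, (2 * pi)%R]) (f t)%:E)%E.
  apply: eq_integral => t _; congr (_%:E); rewrite circle_ptX /f /a /b.
  case: d {a b f F dF cf cF} => u v; simpc => /=; rewrite -/k; ring.
rewrite (@continuous_FTC2 _ f F); first last.
- by move=> t _; rewrite derive1E derive_val.
- split.
  + by move=> t _.
  + exact/cvg_at_right_filter/cF.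
  + exact/cvg_at_left_filter/cF.
- exact: continuous_subspaceT.
- by rewrite mulr_gt0// pi_gt0.
rewrite -EFinB /F !mulr0 sin0 cos0.
have -> : k * (2 * pi) = pi *+ (2 * n.+1) by rewrite /k -[RHS]mulr_natl natrM; ring.
rewrite mulrnA -[_ *+ n.+1]add0r (periodicn (@sinD2pi R)) (periodicn (@cosD2pi R)).
by rewrite sin0 cos0 subrr.
Qed.

Lemma continuous_circle_comp (f : cplx R -> cplx R) (r : R) :
  continuous f -> continuous (f \o circle_pt r).
Proof.
by move=> cf t; apply: continuous_comp; [exact: continuous_circle_pt|exact: cf].
Qed.

Lemma continuous_psum n (c : nat -> R[i]) : continuous (psum n c : cplx R -> cplx R).
Proof. by move=> z; apply: derivable_continuous_at; exact: derivable_psum. Qed.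

Lemma continuous_circle_Re (f : cplx R -> cplx R) (r : R) : continuous f ->
  continuous (fun t => complex.Re (f (circle_pt r t))).
Proof.
move=> cf t; apply: (@continuous_comp _ _ _ (f \o circle_pt r) (@complex.Re R)).
  exact: continuous_circle_comp.
exact: continuous_Re.
Qed.

Lemma continuous_circle_cabs (f : cplx R -> cplx R) (r : R) : continuous f ->
  continuous (fun t => cabs (f (circle_pt r t))).
Proof.
move=> cf t; apply: (@continuous_comp _ _ _ (f \o circle_pt r) (@Normc.normc R)).
  exact: continuous_circle_comp.
exact: continuous_cabs.
Qed.

Lemma continuous_circle_cabs2 (f : cplx R -> cplx R) (r : R) : continuous f ->
  continuous (fun t => cabs (f (circle_pt r t)) ^+ 2).
Proof.
move=> cf t; rewrite /GRing.exp/=.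
by apply: cvgM; exact: continuous_circle_cabs.
Qed.

Lemma integral_circle_psum (r : R) n (c : nat -> R[i]) : c 0%N = 0 ->
  (\int[lebesgue_measure]_(t in `[0%R, (2 * pi)%R])
     (complex.Re (psum n c (circle_pt r t)))%:E = 0)%E.
Proof.
move=> c0; elim: n => [|n IH].
  rewrite (eq_integral (cst 0%E)) ?integral0// => t _.
  by rewrite /psum big_ord0.
transitivity (\int[lebesgue_measure]_(t in `[0%R, (2 * pi)%R])
    ((complex.Re (psum n c (circle_pt r t)))%:E +
     (complex.Re (c n * circle_pt r t ^+ n))%:E))%E.
  apply: eq_integral => t _; rewrite -EFinD /psum big_ord_recr/=; congr (_%:E).
  by case: (\sum_(i < n) _) (c n * _) => [u v] [u' v'].
rewrite integralD_EFin//=; first last.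
- apply: integrable_circle; apply: (@continuous_circle_Re (fun z => c n * z ^+ n)).
  move=> z; apply: derivable_continuous_at; exact: derivable_monomial.
- by apply: integrable_circle; apply: continuous_circle_Re; exact: continuous_psum.
rewrite IH add0e; case: n {IH} => [|n]; last exact: integral_circle_monomial.
rewrite (eq_integral (cst 0%E)) ?integral0// => t _.
by rewrite c0 mul0r.
Qed.

(** Bessel's inequality for the monomials on a circle of radius at most 1. Write
the polynomial as c_0 + z Q; the cross term is the real part of a polynomial
vanishing at 0, so its mean is 0, and |z Q| <= |Q|. *)
Lemma mean_sqr_psum (r : R) n (c : nat -> R[i]) : 0 <= r <= 1 ->
  (\int[lebesgue_measure]_(t in `[0%R, (2 * pi)%R])
     (cabs (psum n c (circle_pt r t)) ^+ 2)%:E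
   <= (2 * pi * \sum_(i < n) cabs (c i) ^+ 2)%:E)%E.
Proof.
move=> /andP[r0 r1]; elim: n c => [|n IH] c.
  rewrite (eq_integral (cst 0%E)) ?integral0 => [|t _].
    by rewrite big_ord0 mulr0.
  by rewrite /psum big_ord0 Normc.normc0 expr0n.
pose c' i := c i.+1.
(* The coefficients of the cross term 2 c_0^* z Q. *)
pose c'' i := if i is j.+1 then 2%:R * (c 0%N)^* * c' j else 0.
have E (z : R[i]) : cabs (psum n.+1 c z) ^+ 2 = cabs (c 0%N) ^+ 2 +
    (cabs z ^+ 2 * cabs (psum n c' z) ^+ 2 + complex.Re (psum n.+1 c'' z)).
  have -> : psum n.+1 c z = c 0%N + z * psum n c' z.
    rewrite /psum big_ord_recl/= expr0 mulr1; congr (_ + _).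
    by rewrite mulr_sumr; apply: eq_bigr => i _; rewrite exprS mulrCA.
  have -> : psum n.+1 c'' z = 2%:R * (c 0%N)^* * (z * psum n c' z).
    rewrite /psum big_ord_recl/= mul0r add0r !mulr_sumr.
    by apply: eq_bigr => i _; rewrite exprS !mulrA; congr (_ * _); rewrite mulrAC.
  rewrite -exprMn -cabsM; move: (z * _) (c 0%N) => [a b] [u v].
  by rewrite !cabs_sqr; simpc => /=; ring.
have cont k d : continuous (fun t => cabs (psum k d (circle_pt r t)) ^+ 2).
  by apply: continuous_circle_cabs2; exact: continuous_psum.
have contRe k d : continuous (fun t => complex.Re (psum k d (circle_pt r t))).
  by apply: continuous_circle_Re; exact: continuous_psum.
have -> : (\int[lebesgue_measure]_(t in `[0%R, (2 * pi)%R])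
     (cabs (psum n.+1 c (circle_pt r t)) ^+ 2)%:E =
   \int[lebesgue_measure]_(t in `[0%R, (2 * pi)%R]) ((cabs (c 0%N) ^+ 2)%:E +
   ((r ^+ 2 * cabs (psum n c' (circle_pt r t)) ^+ 2)%:E +
    (complex.Re (psum n.+1 c'' (circle_pt r t)))%:E)))%E.
  by apply: eq_integral => t _; rewrite -!EFinD E cabs_circle_pt.
have cM : continuous (fun t => r ^+ 2 * cabs (psum n c' (circle_pt r t)) ^+ 2).
  by move=> t; apply: cvgM; [exact: cvg_cst|exact: cont].
rewrite integralD//; first last.
- apply: integrableD => //; exact: integrable_circle.
- by apply: integrable_circle => t; exact: cvg_cst.
rewrite integralD//; [|exact: integrable_circle..].
rewrite integral_circle_psum// adde0 integral_cst//= lebesgue_measure_itv/=.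
rewrite lte_fin mulr_gt0 ?pi_gt0// oppr0 adde0 -EFinM.
have -> : 2 * pi * (\sum_(i < n.+1) cabs (c i) ^+ 2) =
    cabs (c 0%N) ^+ 2 * (2 * pi) + 2 * pi * \sum_(i < n) cabs (c' i) ^+ 2.
  by rewrite big_ord_recl [LHS]mulrDr [X in X + _]mulrC.
rewrite EFinD leeD2l//.
apply: le_trans (IH c'); apply: ge0_le_integral => //.
- by move=> t _; rewrite lee_fin mulr_ge0 ?sqr_ge0.
- by apply/measurable_EFinP; apply: measurable_funTS; exact: continuous_measurable_fun.
- by apply/measurable_EFinP; apply: measurable_funTS; exact: continuous_measurable_fun.
- move=> t _; rewrite lee_fin ler_piMl ?sqr_ge0//.
  by rewrite expr_le1.
Qed.

End circle_means.

(** * Hardy norms of products *)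

Section hardy_products.
Context (R : realType).
Implicit Types (p r B : R) (G : cplx R -> cplx R).

(** Both bases are at most x + y, and the exponents add up to 1. *)
Lemma powR_convex_le (x y th : R) : 0 <= x -> 0 <= y -> 0 <= th <= 1 ->
  x `^ th * y `^ (1 - th) <= x + y.
Proof.
move=> x0 y0 /andP[t0 t1].
have s0 : 0 <= 1 - th by lra.
have [h|h] := leP (x + y) 0.
  have [-> ->] : x = 0 /\ y = 0 by split; lra.
  have [->|tn0] := eqVneq th 1; first by rewrite powRr1// mul0r addr0.
  rewrite [X in _ * X]powR0 ?mulr0 ?addr0// subr_eq0 eq_sym.
  exact: tn0.
have E : (x + y) `^ th * (x + y) `^ (1 - th) = x + y.
  rewrite -powRD; last by rewrite addrC subrK oner_eq0.
  by rewrite (addrC th) subrK powRr1// ltW.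
have xy0 := addr_ge0 x0 y0.
by rewrite -[leRHS]E ler_pM ?powR_ge0 ?ge0_ler_powR ?nnegrE ?lerDl ?lerDr.
Qed.

(** Hölder's inequality with exponents 2/p and 2/(2-p), before integration. As
p >= 1 and g <= 1, the factor g^p may first be replaced by g^(2-p), so that only
the squares of a and g remain. *)
Lemma powR_prod_le p (a g A B : R) : 1 <= p <= 2 -> 0 <= a -> 0 <= g <= 1 ->
  0 < A -> 0 < B ->
  (g * a) `^ p <= A `^ p * B `^ (1 - p / 2) * ((A ^+ 2)^-1 * a ^+ 2 + B^-1 * g ^+ 2).
Proof.
move=> /andP[p1 p2] a0 /andP[g0 g1] A0 B0.
have sq (x s : R) : 0 <= x -> x `^ (2 * s) = (x ^+ 2) `^ s.
  by move=> x0; rewrite powRrM (powR_mulrn 2).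
have hg : g `^ p <= g `^ (2 - p).
  move: g0; rewrite le_eqVlt => /predU1P[<-|g0].
    by rewrite powR0 ?powR_ge0// gt_eqF//; lra.
  by apply: ger_powR; rewrite ?g0//; lra.
rewrite powRM//.
apply: (@le_trans _ _ (g `^ (2 - p) * a `^ p)); first by rewrite ler_wpM2r ?powR_ge0.
have -> : a `^ p = A `^ p * (a ^+ 2 / A ^+ 2) `^ (p / 2).
  rewrite -expr_div_n -sq ?divr_ge0 ?(ltW A0)// mulrCA mulfV// mulr1.
  rewrite -powRM ?divr_ge0 ?(ltW A0)//; congr (_ `^ _).
  by rewrite mulrCA mulfV ?mulr1// gt_eqF.
have -> : g `^ (2 - p) = B `^ (1 - p / 2) * (g ^+ 2 / B) `^ (1 - p / 2).
  rewrite -powRM ?divr_ge0 ?sqr_ge0 ?(ltW B0)//.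
  have -> : B * (g ^+ 2 / B) = g ^+ 2 by rewrite mulrCA mulfV ?mulr1// gt_eqF.
  by rewrite -sq//; congr (_ `^ _); field.
rewrite mulrACA [A `^ p * _]mulrC ler_wpM2l ?mulr_ge0 ?powR_ge0//.
rewrite [leLHS]mulrC [(A ^+ 2)^-1 * _]mulrC [B^-1 * _]mulrC.
apply: powR_convex_le; rewrite ?divr_ge0 ?sqr_ge0 ?(ltW B0)//.
by apply/andP; split; lra.
lra.
Qed.

Definition mean_sqr_le G B := forall r, 0 <= r < 1 ->
  (\int[lebesgue_measure]_(t in `[0%R, (2 * pi)%R])
     (cabs (G (circle_pt r t)) ^+ 2)%:E <= (2 * pi * B)%:E)%E.

(** Integrate [powR_prod_le] on each circle, with A^2 the square sum of the
coefficients. The multiplier enters only through its mean square: a multiplier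
concentrated on a short arc has a small B, which is a gain exactly when p < 2. *)
Lemma hardy_norm_prod p n (c : nat -> R[i]) G B : 1 <= p <= 2 -> 0 < B ->
  continuous G -> (forall z, disk R z -> cabs (G z) <= 1) -> mean_sqr_le G B ->
  (hardy_norm p (fun z => G z * psum n c z)%R <=
    ((2 * B `^ (1 - p / 2)) `^ p^-1 * Num.sqrt (\sum_(i < n) cabs (c i) ^+ 2))%:E)%E.
Proof.
move=> p12 B0 cG G1 GB; have /andP[p1 p2] := p12.
have p_gt0 : 0 < p by lra.
set A := Num.sqrt _.
have s0 : 0 <= \sum_(i < n) cabs (c i) ^+ 2.
  by apply: sumr_ge0 => i _; rewrite sqr_ge0.
have AE : A ^+ 2 = \sum_(i < n) cabs (c i) ^+ 2 by rewrite sqr_sqrtr.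
apply: ge_ereal_sup => _ [r /= /andP[r0 r1] <-].
have pi0 : 0 < 2 * pi :> R by rewrite mulr_gt0// pi_gt0.
suff h : (\int[lebesgue_measure]_(t in `[0%R, (2 * pi)%R])
     (cabs (G (circle_pt r t) * psum n c (circle_pt r t)) `^ p)%:E <=
     (2 * pi * (2 * B `^ (1 - p / 2) * A `^ p))%:E)%E.
  have E : (2 * B `^ (1 - p / 2)) `^ p^-1 * A = (2 * B `^ (1 - p / 2) * A `^ p) `^ p^-1.
    rewrite [RHS]powRM ?mulr_ge0 ?powR_ge0// -[in RHS]powRrM mulfV ?gt_eqF//.
    by rewrite powRr1 ?sqrtr_ge0.
  rewrite E -poweR_EFin.
  have i0 : (0 <= \int[lebesgue_measure]_(t in `[0%R, (2 * pi)%R])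
     (cabs (G (circle_pt r t) * psum n c (circle_pt r t)) `^ p)%:E)%E.
    by apply: integral_ge0 => t _; rewrite lee_fin powR_ge0.
  have i1 : (0 <= ((2 * pi)^-1)%:E * \int[lebesgue_measure]_(t in `[0%R, (2 * pi)%R])
     (cabs (G (circle_pt r t) * psum n c (circle_pt r t)) `^ p)%:E)%E.
    by rewrite mule_ge0// lee_fin invr_ge0 ltW.
  apply: gt0_ler_poweR.
  - by rewrite invr_ge0 ltW.
  - by rewrite in_itv/= i1 leey.
  - by rewrite in_itv/= leey lee_fin !mulr_ge0 ?powR_ge0.
  - apply: le_trans (lee_wpmul2l _ h) _; first by rewrite lee_fin invr_ge0 ltW.
    by rewrite -EFinM lee_fin mulKf// gt_eqF.
have disk_pt t : disk R (circle_pt r t) by rewrite /disk /mkset cabs_circle_pt.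
have : 0 <= A by exact: sqrtr_ge0.
rewrite le_eqVlt => /predU1P[A0|A0].
  have c0 (i : 'I_n) : c i = 0.
    apply/Normc.eq0_normc/eqP; rewrite -sqrf_eq0; apply/eqP.
    move: AE; rewrite -A0 expr0n/= => /esym/psumr_eq0P-> // j _.
    exact: sqr_ge0.
  rewrite (eq_integral (cst 0%E)) => [|t _].
    by rewrite integral0 lee_fin mulr_ge0 ?(ltW pi0)// !mulr_ge0 ?powR_ge0.
  rewrite /psum big1 => [|i _]; last by rewrite c0 mul0r.
  by rewrite mulr0 Normc.normc0 powR0// gt_eqF.
pose K := A `^ p * B `^ (1 - p / 2).
have K0 : 0 <= K by rewrite mulr_ge0 ?powR_ge0.
have mF : measurable_fun `[0%R, (2 * pi)%R]
    (fun t => (cabs (psum n c (circle_pt r t)) ^+ 2)%:E).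
  apply/measurable_EFinP; apply: measurable_funTS; apply: continuous_measurable_fun.
  by apply: continuous_circle_cabs2; exact: continuous_psum.
have mG : measurable_fun `[0%R, (2 * pi)%R]
    (fun t => (cabs (G (circle_pt r t)) ^+ 2)%:E).
  apply/measurable_EFinP; apply: measurable_funTS; apply: continuous_measurable_fun.
  exact: continuous_circle_cabs2.
have A20 : 0 <= (A ^+ 2)^-1 by rewrite invr_ge0 sqr_ge0.
have Bi0 : 0 <= B^-1 by rewrite invr_ge0 ltW.
apply: (@le_trans _ _ (\int[lebesgue_measure]_(t in `[0%R, (2 * pi)%R])
   (K%:E * (((A ^+ 2)^-1)%:E * (cabs (psum n c (circle_pt r t)) ^+ 2)%:E +
     (B^-1)%:E * (cabs (G (circle_pt r t)) ^+ 2)%:E)))%E).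
  apply: ge0_le_integral => //.
  - by move=> t _; rewrite lee_fin powR_ge0.
  - apply/measurable_EFinP; apply: measurable_funTS.
    apply: (@measurableT_comp _ _ _ _ _ _ (fun x : R => x `^ p)) => //.
    under eq_fun do rewrite cabsM.
    by apply: measurable_funM; apply: continuous_measurable_fun;
      apply: continuous_circle_cabs => //; exact: continuous_psum.
  - apply: emeasurable_funM => //; apply: emeasurable_funD; exact: emeasurable_funM.
  - move=> t _; rewrite -!EFinM lee_fin cabsM.
    by apply: powR_prod_le; rewrite ?cabs_ge0//= G1.
rewrite ge0_integralZl//; first last.
- by move=> t _; rewrite adde_ge0 ?mule_ge0 ?lee_fin ?sqr_ge0.
- by apply: emeasurable_funD; exact: emeasurable_funM.
rewrite ge0_integralD//; first last.
- exact: emeasurable_funM.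
- by move=> t _; rewrite mule_ge0 ?lee_fin ?sqr_ge0.
- exact: emeasurable_funM.
- by move=> t _; rewrite mule_ge0 ?lee_fin ?sqr_ge0.
rewrite !ge0_integralZl//; try by move=> t _; rewrite lee_fin sqr_ge0.
have hF := @mean_sqr_psum R r n c; rewrite r0 (ltW r1) in hF.
have {hF} hF := hF isT; rewrite -AE in hF.
have hG : (\int[lebesgue_measure]_(t in `[0%R, (2 * pi)%R])
     (cabs (G (circle_pt r t)) ^+ 2)%:E <= (2 * pi * B)%:E)%E.
  by apply: GB; rewrite r0 r1.
apply: (@le_trans _ _ (K%:E * (((A ^+ 2)^-1)%:E * (2 * pi * A ^+ 2)%:E +
     (B^-1)%:E * (2 * pi * B)%:E))%E).
  by rewrite lee_wpmul2l ?lee_fin// leeD// lee_wpmul2l ?lee_fin.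
rewrite -!EFinM lee_fin /K le_eqVlt; apply/orP; left; apply/eqP.
by field; rewrite !gt_eqF.
Qed.

End hardy_products.

(** * Borel functions on the disk and integrals *)

Section borel_disk.
Context (R : realType).

Lemma continuous_measurable_borelC (g : cplx R -> R) : continuous g ->
  measurable_fun setT (g : borelC R -> R).
Proof.
move=> cg; apply: (measurability _ (RGenOpens.measurableE R)).
move=> _ [_ [a [b ->]] <-]; rewrite setTI.
apply: sub_sigma_algebra.
by apply: open_comp => [x _|]; [exact: cg|exact: interval_open].
Qed.

Lemma measurable_disk : measurable (disk R : set (borelC R)).
Proof.
apply: sub_sigma_algebra.
rewrite (_ : disk R = @Normc.normc R @^-1` [set x | x < 1])//.
by apply: open_comp => [x _|]; [exact: continuous_cabs|exact: open_lt].
Qed.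

End borel_disk.

Section integral_lemmas.
Context d (T : measurableType d) (R : realType) (mu : {measure set T -> \bar R}).
Local Open Scope ereal_scope.

(** Monotone convergence without identifying the limit: it is enough that each
value of [f] is reached by some [g n]. *)
Lemma integral_le_monotone (D : set T) (f : T -> \bar R) (g : nat -> T -> \bar R)
    (K : \bar R) :
  measurable D -> measurable_fun D f -> (forall x, D x -> 0 <= f x) ->
  (forall n, measurable_fun D (g n)) -> (forall n x, D x -> 0 <= g n x) ->
  (forall x, D x -> {homo g ^~ x : m n / (m <= n)%N >-> m <= n}) ->
  (forall x, D x -> exists n, f x <= g n x) ->
  (forall n, \int[mu]_(x in D) g n x <= K) ->
  \int[mu]_(x in D) f x <= K.
Proof.
move=> mD mf f0 mg g0 ndg fg gK.
have cvgg x : D x -> cvgn (g ^~ x).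
  by move=> Dx; apply: ereal_nondecreasing_is_cvgn; exact: ndg.
apply: (@le_trans _ _ (\int[mu]_(x in D) limn (g ^~ x))).
  apply: ge0_le_integral => //.
    by apply: (@emeasurable_fun_cvg _ _ _ _ g) => // x Dx; exact: cvgg.
  move=> x Dx; have [n /le_trans] := fg x Dx; apply.
  rewrite (cvg_lim _ (ereal_nondecreasing_cvgn (ndg x Dx)))//.
  by apply: ereal_sup_ubound; exists n.
rewrite monotone_convergence//; apply: lime_le; last exact: nearW.
apply: ereal_nondecreasing_is_cvgn => m n mn.
by apply: ge0_le_integral => // x Dx; [exact: g0|exact: ndg].
Qed.

Lemma Lnorm_sum (I : Type) (s : seq I) (h : I -> T -> R) (q : R) : (1 <= q)%R ->
  (forall i, measurable_fun [set: T] (h i)) ->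
  'N[mu]_q%:E[EFin \o (fun x => (\sum_(i <- s) h i x)%R)] <=
  \sum_(i <- s) 'N[mu]_q%:E[EFin \o h i].
Proof.
move=> q1 mh; elim: s => [|i s IH].
  rewrite big_nil (_ : _ \o _ = cst 0) ?Lnorm0//.
    by rewrite gt_eqF// lte_fin (lt_le_trans _ q1).
  by apply/funext => x /=; rewrite big_nil.
rewrite big_cons; apply: (@le_trans _ _ ('N[mu]_q%:E[EFin \o h i] +
  'N[mu]_q%:E[EFin \o (fun x => (\sum_(i <- s) h i x)%R)])); last exact: leeD2l.
rewrite (_ : EFin \o _ = EFin \o (h i \+ (fun x => (\sum_(i <- s) h i x)%R))%R).
  by apply: minkowski_EFin => //; exact: measurable_sum.
by apply/funext => x /=; rewrite big_cons.
Qed.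

End integral_lemmas.

(** * The weighted inequality for summing embeddings *)

Section weighted_bound.
Context (R : realType).
Notation signs M := {ffun 'I_M -> bool}.

(** The series sums to 1 / (1 - x^2) >= 1 / (2 (1 - x)); some partial sum exceeds
half of that. *)
Lemma geometric_sqr_ge (x : R) : 0 <= x < 1 ->
  exists M, (4 * (1 - x))^-1 <= \sum_(i < M) (x ^+ i) ^+ 2.
Proof.
move=> /andP[x0 x1]; pose y := x ^+ 2.
have y1 : y < 1 by rewrite /y expr_lt1.
have [M yM] : exists M, y ^+ M <= 1 / 2.
  have y1' : `|y| < 1 by rewrite ger0_norm ?sqr_ge0.
  have h : 0 < 1 / 2 :> R by lra.
  have /cvgr0_norm_le/(_ _ h) [M _ /(_ M (leqnn M))] := cvg_expr y1'.
  by move=> /= /ler_normlP[_ yM]; exists M.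
exists M; have -> : \sum_(i < M) (x ^+ i) ^+ 2 = \sum_(i < M) y ^+ i.
  by apply: eq_bigr => i _; rewrite /y exprAC.
set S := \sum_(i < M) _.
have E : (1 - y) * S = 1 - y ^+ M.
  by apply: oppr_inj; rewrite opprB subrX1 -mulNr opprB.
have hy : 1 - y <= 2 * (1 - x) by rewrite /y expr2; nra.
have S0 : 0 <= S by apply: sumr_ge0 => i _; rewrite exprn_ge0// sqr_ge0.
rewrite -[leLHS]mul1r ler_pdivrMr; last by lra.
nra.
Qed.

(** Apply [summing_signs_le] to the functions G z^i. The average over the signs of
the L^q norms dominates the L^q norm of the average of the moduli, by Minkowski's
inequality, hence that of the square function |G| (sum |z|^(2i))^(1/2), by the
lower Khinchine inequality. The square function increases to a multiple of
|G| (1 - |z|)^(-1/2). It is essential that [K] depends neither on [G] nor on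
[B]. *)
Lemma weighted_bound (p q r : R) (mu : {measure set (borelC R) -> \bar R}) :
  1 <= p <= 2 -> 1 <= q -> 1 <= r -> identity_summing p q r mu ->
  exists2 K : R, 0 <= K & forall (G : cplx R -> cplx R) (B : R),
    (forall z, derivable G z 1) -> (forall z, disk R z -> cabs (G z) <= 1) ->
    0 < B -> mean_sqr_le G B ->
    (\int[mu]_(z in (disk R : set (borelC R)))
       (cabs (G z) `^ q * (1 / (1 - cabs z) `^ (q / 2)))%:E
     <= (K * (B `^ (1 - p / 2)) `^ (q / p))%:E)%E.
Proof.
move=> p12 q1 r1 summ; have /andP[p1 p2] := p12.
have q0 : 0 < q by lra.
have q0' : 0 <= q by lra.
have [b b0 hb] := summing_signs_le (fun g => Lnorm_ge0 _ _ _) r1 summ.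
have [k k0 kE] : exists2 k : R, 0 < k & k = khinchine_lower_const R.
  by exists (khinchine_lower_const R); first exact: khinchine_lower_const_gt0.
exists ((2 * (b / k)) `^ q * 2 `^ (q / p)).
  by rewrite mulr_ge0 ?powR_ge0.
move=> G B dG G1 B0 GB.
have cG : continuous G by move=> z; exact: derivable_continuous_at.
have [D D0 DE] : exists2 D, 0 < D & D = (2 * B `^ (1 - p / 2)) `^ p^-1.
  by exists ((2 * B `^ (1 - p / 2)) `^ p^-1) => //; rewrite powR_gt0// mulr_gt0// powR_gt0.
pose f M (i : 'I_M) : cplx R -> cplx R := fun z => G z * z ^+ i.
(* Coefficients indexed by 'I_M, extended by 0 to a sequence. *)
pose ext M (a : 'I_M -> R[i]) (j : nat) : R[i] := if insub j is Some i then a i else 0.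
have extE M (a : 'I_M -> R[i]) (i : 'I_M) : ext M a i = a i by rewrite /ext valK.
have combE M (a : 'I_M -> R[i]) :
    \sum_i a i *: f M i = (fun z => G z * psum M (ext M a) z).
  apply/funext => z; rewrite fct_sumE /psum mulr_sumr; apply: eq_bigr => i _.
  by rewrite extE /GRing.scale/= /f mulrCA.
have cX M (a : 'I_M -> R[i]) : continuous (\sum_i a i *: f M i : cplx R -> cplx R).
  move=> z; rewrite combE; apply: derivable_continuous_at; apply: derivable_prod => //.
  exact: derivable_psum.
have nX M (a : 'I_M -> R[i]) : (hardy_norm p (\sum_i a i *: f M i)%R <=
    (D * Num.sqrt (\sum_i cabs (a i) ^+ 2))%:E)%E.
  have := @hardy_norm_prod R p M (ext M a) G B p12 B0 cG G1 GB.
  rewrite combE DE; congr (_ <= (_ * Num.sqrt _)%:E)%E.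
  by apply: eq_bigr => i _; rewrite extE.
have hX M (a : 'I_M -> R[i]) : hardy p (\sum_i a i *: f M i).
  split; last by apply: le_lt_trans (nX M a) _; exact: ltry.
  move=> z _; rewrite combE; apply: derivable_prod => //; exact: derivable_psum.
have mcabs (g : cplx R -> cplx R) : continuous g ->
    measurable_fun setT (fun z : borelC R => cabs (g z)).
  move=> cg; apply: continuous_measurable_borelC => z.
  by apply: continuous_comp; [exact: cg|exact: continuous_cabs].
have mid : measurable_fun setT (fun z : borelC R => cabs z).
  by apply: continuous_measurable_borelC; exact: continuous_cabs.
pose S M (z : cplx R) := \sum_(i < M) (cabs z ^+ i) ^+ 2.
have S0 M z : 0 <= S M z by apply: sumr_ge0 => i _; exact: sqr_ge0.
pose g M (z : cplx R) := (cabs (G z) * Num.sqrt (S M z)) `^ q.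
have mg M : measurable_fun (disk R : set (borelC R)) (fun z => (g M z)%:E).
  apply/measurable_EFinP; apply: measurable_funTS.
  apply: (@measurableT_comp _ _ _ _ _ _ (fun x : R => x `^ q)) => //.
  apply: measurable_funM; first exact: mcabs.
  apply: (@measurableT_comp _ _ _ _ _ _ (@Num.sqrt R)).
    by apply: continuous_measurable_fun; exact: sqrt_continuous.
  apply: measurable_sum => i; apply: measurable_funX; exact: measurable_funX.
have key M : (\int[mu]_(z in (disk R : set (borelC R))) (g M z)%:E <=
    ((b * D / k) `^ q)%:E)%E.
  pose X (e : signs M) : cplx R -> cplx R := \sum_i ((-1) ^+ e i : R[i]) *: f M i.
  pose h e : borelC R -> R := (fun z => cabs (X e z)) \_ (disk R).
  have mh e : measurable_fun setT (h e).
    apply/(measurable_restrictT _ (@measurable_disk R)).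
    by apply: measurable_funTS; apply: mcabs; exact: cX.
  have Nh : ('N[mu]_q%:E[EFin \o (fun z => (\sum_e h e z)%R)] <=
      (2 ^+ M * (b * D))%:E)%E.
    apply: le_trans (Lnorm_sum mu _ q1 mh) _.
    apply: le_trans (hb M (f M) D D0 (hX M) (nX M)).
    by apply: lee_sum => e _; rewrite /Lq_norm restrict_EFin.
  have h0 e z : 0 <= h e z by rewrite /h patchE; case: ifP => // _; exact: cabs_ge0.
  have I1 : (\int[mu]_z ((\sum_e h e z) `^ q)%:E <= ((2 ^+ M * (b * D)) `^ q)%:E)%E.
    have qn0 : q != 0 by rewrite gt_eqF.
    have := poweR_Lnorm mu (EFin \o (fun z => (\sum_e h e z)%R)) qn0.
    under [X in _ = X -> _]eq_integral => z _.
      rewrite /= ger0_norm; last by apply: sumr_ge0 => e _.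
      over.
    move=> <-; rewrite -poweR_EFin; apply: gt0_ler_poweR => //.
    - by rewrite in_itv/= leey andbT Lnorm_ge0.
    - by rewrite in_itv/= leey andbT lee_fin !mulr_ge0 ?exprn_ge0// ltW.
  have mhq : measurable_fun setT (fun z : borelC R => (\sum_e h e z) `^ q).
    apply: (@measurableT_comp _ _ _ _ _ _ (fun x : R => x `^ q)) => //.
    exact: measurable_sum.
  pose w := (k * 2 ^+ M)^-1.
  have w0 : 0 <= w by rewrite invr_ge0 mulr_ge0 ?exprn_ge0 ?(ltW k0).
  apply: (@le_trans _ _ (\int[mu]_z ((w `^ q)%:E * ((\sum_e h e z) `^ q)%:E))%E).
    rewrite integral_mkcond; apply: ge0_le_integral => //.
    - by move=> z _; rewrite patchE; case: ifP => // _; rewrite lee_fin powR_ge0.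
    - exact/(measurable_restrictT _ (@measurable_disk R)).
    - by apply: emeasurable_funM => //; exact/measurable_EFinP.
    - move=> z _; rewrite patchE; case: ifPn => [|_]; last first.
        by rewrite -EFinM lee_fin mulr_ge0 ?powR_ge0.
      rewrite inE => zD; rewrite -EFinM lee_fin /g -powRM//; last first.
        by apply: sumr_ge0 => e _; exact: h0.
      have hz e : h e z = cabs (\sum_i (-1) ^+ e i * (G z * z ^+ i)).
        rewrite /h patchE ifT ?inE// /X fct_sumE; congr cabs.
      rewrite ge0_ler_powR ?nnegrE ?mulr_ge0 ?cabs_ge0 ?sqrtr_ge0//.
        by apply: sumr_ge0 => e _; exact: h0.
      rewrite [w * _]mulrC /w ler_pdivlMr ?mulr_gt0 ?exprn_gt0//.
      rewrite (eq_bigr _ (fun e _ => hz e)).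
      apply: le_trans (khinchine_lower _).
      rewrite mulrC -kE ler_wpM2l ?mulr_ge0 ?exprn_ge0 ?(ltW k0)//.
      rewrite -(ler_pXn2r (n := 2)) ?nnegrE ?mulr_ge0 ?cabs_ge0 ?sqrtr_ge0//.
      rewrite exprMn !sqr_sqrtr//; last by apply: sumr_ge0 => i _; exact: sqr_ge0.
      rewrite /S mulr_sumr; apply: ler_sum => i _.
      by rewrite cabsM cabsX exprMn.
  rewrite ge0_integralZl//; first last.
  - by rewrite lee_fin powR_ge0.
  - by move=> z _; rewrite lee_fin powR_ge0.
  - exact/measurable_EFinP.
  apply: le_trans (lee_wpmul2l _ I1) _; first by rewrite lee_fin powR_ge0.
  rewrite -EFinM lee_fin -powRM ?mulr_ge0 ?exprn_ge0 ?(ltW b0) ?(ltW D0)//.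
  have -> : w * (2 ^+ M * (b * D)) = b * D / k.
    by rewrite /w; field; rewrite !gt_eqF ?exprn_gt0.
  by [].
have mf : measurable_fun (disk R : set (borelC R))
    (fun z => ((cabs (G z) * (4 * (1 - cabs z)) `^ (- 2^-1)) `^ q)%:E).
  apply/measurable_EFinP; apply: measurable_funTS.
  apply: (@measurableT_comp _ _ _ _ _ _ (fun x : R => x `^ q)) => //.
  apply: measurable_funM; first exact: mcabs.
  apply: (@measurableT_comp _ _ _ _ _ _ (fun x : R => x `^ (- 2^-1))) => //.
  by apply: measurable_funM => //; exact: measurable_funB.
have lim : (\int[mu]_(z in (disk R : set (borelC R)))
    ((cabs (G z) * (4 * (1 - cabs z)) `^ (- 2^-1)) `^ q)%:E <=
    ((b * D / k) `^ q)%:E)%E.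
  apply: (@integral_le_monotone _ (borelC R) R mu (disk R) _ (fun M z => (g M z)%:E)).
  - exact: measurable_disk.
  - exact: mf.
  - by move=> z _; rewrite lee_fin powR_ge0.
  - exact: mg.
  - by move=> M z _; rewrite lee_fin powR_ge0.
  - move=> z _ m n mn; rewrite lee_fin /g.
    rewrite ge0_ler_powR ?nnegrE ?mulr_ge0 ?cabs_ge0 ?sqrtr_ge0//.
    rewrite ler_wpM2l ?cabs_ge0// ler_wsqrtr// /S.
    rewrite -(subnKC mn) big_split_ord/= lerDl.
    by apply: sumr_ge0 => i _; exact: sqr_ge0.
  - move=> z zD.
    have [|M hM] := @geometric_sqr_ge (cabs z); first by rewrite cabs_ge0.
    exists M; rewrite lee_fin /g.
    rewrite ge0_ler_powR ?nnegrE ?mulr_ge0 ?cabs_ge0 ?sqrtr_ge0 ?powR_ge0//.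
    have x0 : 0 <= 4 * (1 - cabs z) by rewrite mulr_ge0// subr_ge0 ltW.
    by rewrite ler_wpM2l ?cabs_ge0// powRN powR12_sqrt// -sqrtrV// ler_wsqrtr.
  - exact: key.
rewrite (_ : \int[mu]_(z in _) _ = \int[mu]_(z in (disk R : set (borelC R)))
    ((2 `^ q)%:E * ((cabs (G z) * (4 * (1 - cabs z)) `^ (- 2^-1)) `^ q)%:E))%E.
  rewrite ge0_integralZl; first last.
  - by rewrite lee_fin powR_ge0.
  - by move=> z _; rewrite lee_fin powR_ge0.
  - exact: mf.
  - exact: measurable_disk.
  apply: le_trans (lee_wpmul2l _ lim) _; first by rewrite lee_fin powR_ge0.
  rewrite -EFinM lee_fin -powRM ?mulr_ge0 ?invr_ge0 ?(ltW b0) ?(ltW D0) ?(ltW k0)//.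
  have -> : 2 * (b * D / k) = 2 * (b / k) * D by ring.
  have bk0 : 0 <= 2 * (b / k) by rewrite mulr_ge0// divr_ge0// ltW.
  rewrite (powRM _ bk0 (ltW D0)) -mulrA DE -powRrM [p^-1 * q]mulrC.
  by rewrite [(2 * B `^ _) `^ _]powRM ?powR_ge0.
apply: eq_integral => z; rewrite inE /disk /mkset => z1; rewrite -EFinM; congr (_%:E).
have x0 : 0 < 1 - cabs z by lra.
rewrite [in RHS]powRM ?cabs_ge0 ?powR_ge0// [RHS]mulrCA; congr (_ * _).
rewrite -powRrM powRM ?(ltW x0)// mulrA.
have -> : 4 = 2 `^ 2 :> R by rewrite (powR_mulrn 2)// -natrX.
rewrite -powRrM -powRD; last by rewrite pnatr_eq0 implybT.
have -> : q + 2 * (- 2^-1 * q) = 0 by field.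
rewrite powRr0 !mul1r -powRN; congr (_ `^ _); by field.
Qed.

End weighted_bound.

(** * A curve tangent to the circle *)

Section curve.
Context (R : realType).

(** At 0 the function is squeezed by |t|, and elsewhere the power is
differentiable. *)
Lemma continuous_norm_powR (a : R) : 1 <= a -> continuous (fun t : R => `|t| `^ a).
Proof.
move=> a1 t; have a0 : 0 < a by lra.
have [->|t0] := eqVneq t 0.
  apply/cvgrPdist_le => e e0; rewrite normr0 powR0 ?gt_eqF//.
  near=> s; rewrite sub0r normrN ger0_norm ?powR_ge0//.
  have s1 : `|s| <= Num.min e 1.
    near: s; have m0 : 0 < Num.min e 1 by rewrite lt_min e0/=.
    have /cvgr0_norm_le/(_ _ m0) := @cvg_id R (nbhs (0 : R)).
    by apply: filterS.
  have [s0|s0] := eqVneq s 0; first by rewrite s0 normr0 powR0 ?gt_eqF// ltW.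
  move: s1; rewrite le_min => /andP[se s1]; apply: le_trans se.
  by apply: ge1r_powR => //; rewrite normr_gt0 s0 s1.
apply: (@continuous_comp _ _ _ (@Num.norm _ R) (fun x : R => x `^ a)).
  exact: norm_continuous.
apply/differentiable_continuous/derivable1_diffP.
by apply: derivable_powR; rewrite in_itv/= andbT normr_gt0.
Unshelve. all: by end_near. Qed.

(** For t in [0, 1], the point at distance t^a from the unit circle, in the
direction of the unit vector with imaginary part t. It is tangent to the circle
at 1, to an order measured by [a]. *)
Definition curve (a t : R) : cplx R :=
  ((1 - `|t| `^ a) * Num.sqrt (1 - t ^+ 2)) +i* ((1 - `|t| `^ a) * t).

Lemma continuous_curve (a : R) : 1 <= a -> continuous (curve a).
Proof.
move=> a1 t.
have cw : {for t, continuous (fun s : R => 1 - `|s| `^ a)}.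
  by apply: cvgB; [exact: cvg_cst|exact: continuous_norm_powR].
apply: (@continuous_complex _ (fun s => (1 - `|s| `^ a) * Num.sqrt (1 - s ^+ 2))
  (fun s => (1 - `|s| `^ a) * s)); last by apply: cvgM => //; exact: cvg_id.
apply: cvgM => //.
apply: (@continuous_comp _ _ _ (fun s : R => 1 - s ^+ 2) (@Num.sqrt R)).
  apply: cvgB; first exact: cvg_cst.
  exact: exprn_continuous.
exact: sqrt_continuous.
Qed.

Lemma measurable_curve (a : R) : 1 <= a ->
  measurable_fun setT (curve a : measurableTypeR R -> borelC R).
Proof.
move=> a1; apply: (measurability _ (erefl _ : @measurable _ (borelC R) = <<s @open (cplx R) >>)).
move=> _ [A oA <-]; rewrite setTI; apply: open_measurable.
by apply: open_comp => // x _; exact: continuous_curve.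
Qed.

Lemma cabs_curve (a t : R) : 1 <= a -> 0 <= t <= 1 -> cabs (curve a t) = 1 - t `^ a.
Proof.
move=> a1 /andP[t0 t1]; rewrite /curve/= (ger0_norm t0).
have ta : t `^ a <= 1.
  have a0 : 0 <= a by lra.
  have : t `^ a <= 1 `^ a by rewrite ge0_ler_powR ?nnegrE.
  by rewrite powR1.
rewrite !exprMn -mulrDr sqr_sqrtr; last by rewrite subr_ge0 expr_le1.
by rewrite subrK mulr1 sqrtr_sqr ger0_norm// subr_ge0.
Qed.

(** The image of Lebesgue measure on [0, 1], characterised by its change of
variables formula. *)
Lemma curve_measure (a : R) : 1 <= a ->
  exists mu : {measure set (borelC R) -> \bar R},
    forall f : borelC R -> \bar R, measurable_fun setT f ->
      (forall z, 0 <= f z)%E ->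
      (\int[mu]_z f z = \int[lebesgue_measure]_(t in `[0%R, 1%R]) f (curve a t))%E.
Proof.
move=> a1.
pose X : {mfun measurableTypeR R >-> borelC R} :=
  HB.pack (curve a : measurableTypeR R -> borelC R)
    (isMeasurableFun.Build _ _ _ _ _ (measurable_curve a1)).
exists (distribution (uniform_prob (@ltr01 R)) X) => f mf f0.
rewrite ge0_integral_distribution// integral_uniform.
- by rewrite subr0 invr1 mul1e.
- by apply: measurableT_comp => //; exact: measurable_curve.
- by move=> t; exact: f0.
Qed.

End curve.

(** * The image measure is a Carleson measure *)

Section curve_measure_properties.
Context (R : realType) (a : R) (mu : {measure set (borelC R) -> \bar R}).
Context (a1 : 1 <= a).
Context (hmu : forall f : borelC R -> \bar R, measurable_fun setT f ->
  (forall z, 0 <= f z)%E ->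
  (\int[mu]_z f z = \int[lebesgue_measure]_(t in `[0%R, 1%R]) f (curve a t))%E).

Lemma curve_measure_le (A : set (borelC R)) (B : set (measurableTypeR R)) :
  measurable A -> measurable B ->
  (forall t, 0 <= t <= 1 -> A (curve a t) -> B t) ->
  (mu A <= lebesgue_measure B)%E.
Proof.
move=> mA mB AB.
have -> : mu A = (\int[mu]_z (\1_A z)%:E)%E by rewrite integral_indic// setIT.
rewrite hmu; first last.
- by move=> z; rewrite lee_fin.
- exact/measurable_EFinP/measurable_indic.
apply: (@le_trans _ _ (\int[lebesgue_measure]_(t in `[0%R, 1%R]) (\1_B t)%:E)%E).
  apply: ge0_le_integral => //.
  - apply: measurable_funTS; apply/measurable_EFinP.
    apply: (@measurableT_comp _ _ _ _ _ _ (\1_A : borelC R -> R)).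
      exact: measurable_indic.
    exact: measurable_curve.
  - by apply: measurable_funTS; apply/measurable_EFinP/measurable_indic.
  - move=> t; rewrite /= in_itv/= => t01; rewrite lee_fin !indicE.
    have [/set_mem At|] := boolP (curve a t \in A); last by rewrite ler0n.
    by rewrite mem_set//; exact: AB.
rewrite integral_indic//; apply: le_measure; rewrite ?inE//.
exact: measurableI.
Qed.

Lemma curve_measure_on_disk : on_disk mu.
Proof.
apply/eqP; rewrite eq_le measure_ge0 andbT.
rewrite -(lebesgue_measure_set1 (0 : R)).
apply: curve_measure_le => //.
  by apply: measurableC; exact: measurable_disk.
move=> t t01; rewrite /setC/= /disk /mkset cabs_curve//.
have [->//|t0] := eqVneq t 0; case/andP: t01 => t0' t1.
by case; rewrite ltrBlDr ltrDl powR_gt0// lt_def t0.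
Qed.

Lemma sin_le_id (x : R) : 0 <= x -> `|sin x| <= x.
Proof.
move=> x0; have [c _] := @MVT_segment R sin cos 0 x x0
  (fun y _ => is_derive_sin y) (continuous_subspaceT (@continuous_sin R)).
rewrite sin0 !subr0 => ->; rewrite normrM (ger0_norm x0).
by rewrite ler_piMl// cos_max.
Qed.

Lemma one_sub_cos_le (h : R) : 0 <= h -> 1 - cos h <= h ^+ 2 / 2.
Proof.
move=> h0; have hh : 0 <= h / 2 by rewrite divr_ge0.
have := sin_le_id hh; rewrite -(ler_pXn2r (n := 2)) ?nnegrE//.
rewrite real_normK ?num_real//.
have := cos2Dsin2 (h / 2).
rewrite [in cos h](splitr h) cosD -!expr2 expr_div_n.
move: (cos _ ^+ 2) (sin _ ^+ 2) => u v; lra.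
Qed.

(** The Carleson window at [xi] in terms of the cosine of the argument, a form in
which it is a closed set. *)
Definition sector (xi : cplx R) (h : R) : set (borelC R) :=
  [set z | 1 - h <= cabs z /\ (cabs z <= 1 /\ cos h * cabs z <= complex.Re (z * xi^*))].

(** The modulus of the principal argument is an arc cosine, and the cosine is
decreasing on [0, pi]. *)
Lemma carleson_windowE (xi : cplx R) (h : R) : cabs xi = 1 -> 0 < h < 1 ->
  carleson_window xi h = sector xi h.
Proof.
move=> xi1 /andP[h0 h1]; apply/seteqP.
suff H (z : cplx R) : 0 < cabs z ->
    (`|carg (z * xi^*)| <= h) = (cos h * cabs z <= complex.Re (z * xi^*)).
  split=> z /=.
    move=> [/andP[h1' z1] zh]; split => //; split => //; rewrite -H//; lra.
  move=> [h1' [z1 zh]]; split; first by rewrite h1' z1.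
  by rewrite H//; lra.
move=> z0; set w := z * xi^*.
have cw : cabs w = cabs z by rewrite /w cabsM cabsJ xi1 mulr1.
pose x := complex.Re w / cabs w.
have w0 : 0 < cabs w by rewrite cw.
have x1 : -1 <= x <= 1.
  have := Re_le_cabs w; rewrite ler_norml /x => /andP[l u].
  by rewrite ler_pdivlMr// mulN1r l ler_pdivrMr// mul1r u.
have -> : `|carg w| = acos x.
  by rewrite /carg -/x; case: ifP => _; rewrite ?normrN ger0_norm// acos_ge0.
have hpi : h <= pi.
  by have := pi_ge2 R; lra.
rewrite -cw -ler_pdivlMr// -/x -[in RHS](@acosK _ x) ?in_itv//.
have hI : h \in `[0, pi] by rewrite in_itv/= (ltW h0).
have aI : acos x \in `[0, pi] by rewrite in_itv/= acos_ge0// acos_lepi.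
by rewrite !leNgt (ltr_cos hI aI).
Qed.

Lemma measurable_sector (xi : cplx R) (h : R) : measurable (sector xi h).
Proof.
have mid : measurable_fun setT (fun z : borelC R => cabs z).
  by apply: continuous_measurable_borelC; exact: continuous_cabs.
have mRe : measurable_fun setT (fun z : borelC R => complex.Re (z * xi^*)).
  apply: continuous_measurable_borelC => z.
  apply: (@continuous_comp _ _ _ (fun z : cplx R => z * xi^* : cplx R) (@complex.Re R)).
    apply: derivable_continuous_at; apply: derivable_prod.
      exact: derivable_id.
    exact: derivable_cst.
  exact: continuous_Re.
have mge (f : borelC R -> R) : measurable_fun setT f -> measurable [set z | 0 <= f z].
  move=> mf; rewrite (_ : [set z | _] = setT `&` f @^-1` `[0, +oo[).
    exact: mf.
  by apply/seteqP; split => z /=; rewrite in_itv/= andbT; [move=> ?; split|case].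
have m1 := mge (fun z => cabs z - (1 - h)).
have m2 := mge (fun z => 1 - cabs z).
have m3 := mge (fun z => complex.Re (z * xi^*) - cos h * cabs z).
rewrite (_ : sector _ _ = [set z | 0 <= cabs z - (1 - h)] `&` ([set z | 0 <= 1 - cabs z] `&`
   [set z | 0 <= complex.Re (z * xi^*) - cos h * cabs z])).
  apply: measurableI; first by apply: m1; exact: measurable_funB.
  apply: measurableI; first by apply: m2; exact: measurable_funB.
  by apply: m3; apply: measurable_funB => //; exact: measurable_funM.
by apply/seteqP; split => z; rewrite /sector /mkset/= !subr_ge0.
Qed.

(** Two unit vectors at an angle at most h are at distance at most h, so their
imaginary parts differ by at most h; the imaginary part of the direction of the
curve is its parameter. *)
Lemma sector_curve (xi : cplx R) (h t : R) : cabs xi = 1 -> 0 < h < 1 -> 0 <= t <= 1 ->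
  sector xi h (curve a t) -> `|t - complex.Im xi| <= h.
Proof.
move=> xi1 /andP[h0 h1] t01 [+ [_ +]].
rewrite cabs_curve// => hr; case/andP: (t01) => t0 t1.
set rho := 1 - t `^ a in hr *; have rho0 : 0 < rho by lra.
case: xi xi1 => u v; rewrite /curve (ger0_norm t0) -/rho => xi1.
have uv : u ^+ 2 + v ^+ 2 = 1.
  by have := cabs_sqr (u +i* v); rewrite xi1 expr1n => /esym.
set s := Num.sqrt _.
have st : s ^+ 2 + t ^+ 2 = 1.
  by rewrite sqr_sqrtr ?subrK// subr_ge0 expr_le1.
simpc => /=.
have -> : rho * s * u + rho * t * v = (s * u + t * v) * rho by ring.
rewrite ler_pM2r// => hc.
have := one_sub_cos_le (ltW h0) => hcos.
rewrite -(ler_pXn2r (n := 2)) ?nnegrE ?(ltW h0)// real_normK ?num_real//.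
have := sqr_ge0 (s - u); nra.
Qed.

(** By [sector_curve], a window of size h only sees an interval of parameters of
length 2 h. *)
Lemma curve_measure_carleson : carleson mu.
Proof.
exists 2; near=> h.
have h01 : 0 < h < 1.
  apply/andP; split; near: h; first exact: nbhs_right_gt.
  exact: nbhs_right_lt.
apply: ge_ereal_sup => _ [xi xi1 <-].
rewrite carleson_windowE//.
have -> : ((2 * h)%:E = lebesgue_measure `[(complex.Im xi - h)%R, (complex.Im xi + h)%R])%E.
  case/andP: h01 => h0 _.
  rewrite lebesgue_measure_itv/= lte_fin ifT; last by lra.
  by rewrite -EFinB; congr (_%:E); ring.
apply: curve_measure_le => //; first exact: measurable_sector.
move=> t t01 /(sector_curve xi1 h01 t01); rewrite ler_norml => /andP[l u].
by rewrite /= in_itv/=; apply/andP; split; lra.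
Unshelve. all: by end_near. Qed.

Lemma integral_disk_curve (f : borelC R -> \bar R) :
  measurable_fun (disk R : set (borelC R)) f -> (forall z, 0 <= f z)%E ->
  (\int[mu]_(z in (disk R : set (borelC R))) f z =
   \int[lebesgue_measure]_(t in `[0%R, 1%R]) (f \_ (disk R)) (curve a t))%E.
Proof.
move=> mf f0; rewrite integral_mkcond hmu//.
  by apply/(measurable_restrictT _ (@measurable_disk R)).
by move=> z; rewrite patchE; case: ifP.
Qed.

End curve_measure_properties.

(** * Integrals and multipliers along the curve *)

Section power_integral.
Context (R : realType).

(** Exhaust ]0, 1] by the intervals [1/(n+2), 1], on which the integrand has the
continuous antiderivative t^(1-b) / (1-b). At t = 0 the power -b evaluates to 0. *)
Lemma integral_powR_le (b : R) : 0 < b -> b < 1 ->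
  (\int[lebesgue_measure]_(t in `[0%R, 1%R]) (t `^ (- b))%:E <= ((1 - b)^-1)%:E)%E.
Proof.
move=> b0 b1.
have mp : measurable_fun setT (fun t : measurableTypeR R => (t `^ (- b))%:E).
  by apply/measurable_EFinP; exact: measurable_powR.
pose e (n : nat) : R := n.+2%:R^-1.
have e0 n : 0 < e n by rewrite invr_gt0.
have e1 n : e n < 1 by rewrite invf_lt1// ltr1n.
pose g (n : nat) : measurableTypeR R -> \bar R :=
  (fun t : R => (t `^ (- b))%:E) \_ `[e n, 1].
have g0 n t : (0 <= g n t)%E.
  by rewrite /g patchE; case: ifP => // _; rewrite lee_fin powR_ge0.
apply: (@integral_le_monotone _ _ _ _ _ _ g).
- by [].
- exact: measurable_funTS.
- by move=> t _; rewrite lee_fin powR_ge0.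
- move=> n; apply: measurable_funTS.
  by apply/(measurable_restrictT _ (measurable_itv _)); exact: measurable_funTS.
- by move=> n t _; exact: g0.
- move=> t _ m n mn; rewrite {1}/g patchE; case: ifPn => // /set_mem.
  rewrite /= in_itv/= => /andP[et t1]; rewrite /g patchE ifT//.
  rewrite inE/= in_itv/= t1 andbT; apply: le_trans et.
  by rewrite /e lef_pV2 ?posrE// ler_nat.
- move=> t; rewrite /= in_itv/= => /andP[t0 t1].
  have [->|tn0] := eqVneq t 0.
    exists 0%N; rewrite powR0; first exact: g0.
    by rewrite oppr_eq0 gt_eqF.
  have tp : 0 < t by rewrite lt_def tn0.
  have [n nt] : exists n, e n <= t.
    exists (Num.truncn t^-1); rewrite /e invf_ple ?posrE//.
    apply/ltW/(lt_le_trans (real_truncnS_gt (num_real _))).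
    by rewrite ler_nat.
  exists n; rewrite /g patchE ifT//.
  by rewrite inE/= in_itv/= nt.
- move=> n; rewrite /g -integral_mkcondr setIidr; last first.
    move=> t; rewrite /= !in_itv/= => /andP[et ->]; rewrite andbT.
    by apply: le_trans et; exact: ltW.
  pose F (t : R) := (1 - b)^-1 * t `^ (1 - b).
  have dF (t : R) : 0 < t -> is_derive t 1 F (t `^ (- b)).
    move=> t0; have h := is_derive1_powR (1 - b) t0.
    rewrite (_ : F = (1 - b)^-1 \*: (fun t => t `^ (1 - b))); last by apply/funext.
    apply: is_derive_eq; rewrite /GRing.scale/=.
    rewrite addrAC subrr sub0r mulrA mulVf ?mul1r//.
    by rewrite gt_eqF// subr_gt0.
  have cF (t : R) : 0 < t -> {for t, continuous F}.
    move=> t0; apply/differentiable_continuous/derivable1_diffP.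
    by have [] := dF t t0.
  rewrite (@continuous_FTC2 _ _ F).
  + rewrite /F powR1 mulr1 -EFinB lee_fin lerBlDr lerDl.
    by rewrite mulr_ge0 ?powR_ge0// invr_ge0 subr_ge0 ltW.
  + exact: e1.
  + apply: continuous_in_subspaceT => t /set_mem; rewrite /= in_itv/= => /andP[et _].
    have t0 := lt_le_trans (e0 n) et.
    apply/differentiable_continuous/derivable1_diffP.
    by apply: derivable_powR; rewrite in_itv/= andbT.
  + split.
    * move=> t; rewrite in_itv/= => /andP[et _].
      by have [] := dF t (lt_trans (e0 n) et).
    * exact/cvg_at_right_filter/cF/e0.
    * exact/cvg_at_left_filter/cF/ltr01.
  + move=> t; rewrite in_itv/= => /andP[et _].
    by have h := dF t (lt_trans (e0 n) et); rewrite derive1E derive_val.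
Qed.

End power_integral.

Section geometric_means.
Context (R : realType).

(** The mean of 1, z, ..., z^(N-1): it is bounded by 1 on the disk, its mean
squares on circles are at most 1/N, and it is at least 1/2 in modulus within
distance 1/(2N) of 1. *)
Definition geometric_mean (N : nat) : cplx R -> cplx R :=
  psum N (fun=> (N%:R^-1 : R)%:C).

Lemma geometric_mean_le1 N (z : cplx R) : disk R z -> cabs (geometric_mean N z) <= 1.
Proof.
rewrite /disk /mkset => z1.
apply: le_trans (cabs_sum _ _ _) _.
apply: (@le_trans _ _ (\sum_(i < N) N%:R^-1)).
  apply: ler_sum => i _; rewrite cabsM cabs_real cabsX ger0_norm ?invr_ge0//.
  by rewrite ler_piMr ?invr_ge0// exprn_ile1 ?cabs_ge0// ltW.
rewrite sumr_const card_ord -[leLHS]mulr_natr.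
by case: N => [|N]; rewrite ?mulr0// mulVf ?pnatr_eq0.
Qed.

Lemma mean_sqr_geometric_mean N : (0 < N)%N ->
  mean_sqr_le (geometric_mean N) N%:R^-1.
Proof.
move=> N0 r /andP[r0 r1].
have := @mean_sqr_psum R r N (fun=> (N%:R^-1 : R)%:C); rewrite r0 (ltW r1) => /(_ isT).
rewrite (eq_bigr (fun=> N%:R^-1 ^+ 2)) => [|i _]; last first.
  by rewrite cabs_real real_normK ?num_real.
rewrite sumr_const card_ord -[_ ^+ 2 *+ N]mulr_natr expr2 -[_ * _ * N%:R]mulrA mulVf ?mulr1//.
by rewrite pnatr_eq0 -lt0n.
Qed.

Lemma one_sub_expr_le (z : R[i]) n : cabs z <= 1 ->
  cabs (1 - z ^+ n) <= n%:R * cabs (1 - z).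
Proof.
move=> z1; rewrite -[cabs (1 - z ^+ n)]normcN opprB subrX1 cabsM.
rewrite -[cabs (z - 1)]normcN opprB mulrC ler_wpM2r ?cabs_ge0//.
apply: le_trans (cabs_sum _ _ _) _.
rewrite -[X in _ <= X%:R]card_ord -sumr_const; apply: ler_sum => i _.
by rewrite cabsX exprn_ile1 ?cabs_ge0.
Qed.

(** Here 1 - geometric_mean is the mean of the 1 - z^i, and
|1 - z^i| <= i |1 - z|. *)
Lemma geometric_mean_near1 N (z : cplx R) : (0 < N)%N -> cabs z <= 1 ->
  N%:R * cabs (1 - z) <= 1 / 2 -> 1 / 2 <= cabs (geometric_mean N z).
Proof.
move=> N0 z1 hz.
have Nn0 : N%:R != 0 :> R by rewrite pnatr_eq0 -lt0n.
have E : 1 - geometric_mean N z = \sum_(i < N) (N%:R^-1 : R)%:C * (1 - z ^+ i).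
  under eq_bigr do rewrite mulrBr mulr1.
  rewrite sumrB sumr_const card_ord; congr (_ - _).
  by rewrite -rmorphMn/= -[_^-1 *+ N]mulr_natr mulVf.
have : cabs (1 - geometric_mean N z) <= 1 / 2.
  rewrite E; apply: le_trans (cabs_sum _ _ _) _; apply: le_trans hz.
  apply: (@le_trans _ _ (\sum_(i < N) N%:R^-1 * (N%:R * cabs (1 - z)))).
    apply: ler_sum => i _; rewrite cabsM cabs_real ger0_norm ?invr_ge0//.
    rewrite ler_wpM2l ?invr_ge0//; apply: le_trans (one_sub_expr_le _ z1) _.
    by rewrite ler_wpM2r ?cabs_ge0// ler_nat ltnW.
  by rewrite sumr_const card_ord -[leLHS]mulr_natr mulrC mulVKf.
have := cabsD (1 - geometric_mean N z) (geometric_mean N z).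
rewrite subrK Normc.normc1; lra.
Qed.

(** The radial displacement is t^a <= t, and the vertical and horizontal
displacements of the direction are at most t. *)
Lemma curve_near1 (a t : R) : 1 <= a -> 0 <= t <= 1 ->
  cabs (1 - curve a t) <= 3 * t.
Proof.
move=> a1 /andP[t0 t1]; apply: le_trans (cabs_le_ReIm _) _.
rewrite /curve (ger0_norm t0).
have ta : t `^ a <= t.
  move: t0; rewrite le_eqVlt => /predU1P[<-|t0]; first by rewrite powR0// gt_eqF//; lra.
  by apply: ge1r_powR => //; rewrite t0 t1.
have ta0 := powR_ge0 t a.
set s := Num.sqrt _; set rho := 1 - t `^ a.
have rho01 : 1 - t <= rho <= 1 by rewrite /rho; apply/andP; split; lra.
have s0 : 0 <= s by exact: sqrtr_ge0.
have s2 : s ^+ 2 = 1 - t ^+ 2 by rewrite sqr_sqrtr// subr_ge0 expr_le1.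
have s1 : s <= 1.
  rewrite -(ler_pXn2r (n := 2)) ?nnegrE// s2 expr1n lerBlDr lerDl sqr_ge0//.
have st : 1 - t <= s.
  have t1' : 0 <= 1 - t by lra.
  rewrite -(ler_pXn2r (n := 2)) ?nnegrE// s2; nra.
case/andP: rho01 => r0 r1; simpc => /=.
rewrite normrN ger0_norm; last by nra.
rewrite ger0_norm; last by nra.
nra.
Qed.

End geometric_means.

(** * Necessity, and failure of sufficiency *)

Section counterexample.
Context (R : realType) (a p : R) (mu : {measure set (borelC R) -> \bar R}).
Context (a1 : 1 <= a).
Context (hmu : forall f : borelC R -> \bar R, measurable_fun setT f ->
  (forall z, 0 <= f z)%E ->
  (\int[mu]_z f z = \int[lebesgue_measure]_(t in `[0%R, 1%R]) f (curve a t))%E).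

Let b := a * (p / 2).

Lemma weight_curve (t : R) : 0 <= t <= 1 ->
  1 / (1 - cabs (curve a t)) `^ (p / 2) = t `^ (- b).
Proof.
move=> t01; rewrite cabs_curve// opprB addrC subrK mul1r -powRN -powRrM.
by rewrite /b mulrN.
Qed.

Lemma measurable_weight :
  measurable_fun setT (fun z : borelC R => 1 / (1 - cabs z) `^ (p / 2)).
Proof.
rewrite (_ : (fun _ => _) = (fun z : borelC R => (1 - cabs z) `^ (- (p / 2)))).
  apply: (@measurableT_comp _ _ _ _ _ _ (fun x : R => x `^ (- (p / 2)))) => //.
  apply: measurable_funB => //.
  by apply: continuous_measurable_borelC; exact: continuous_cabs.
by apply/funext => z; rewrite mul1r -powRN.
Qed.

Lemma weight_ge0 (z : R[i]) : 0 <= 1 / (1 - cabs z) `^ (p / 2).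
Proof. by rewrite mul1r invr_ge0 powR_ge0. Qed.

Lemma curve_weight_integral : 0 < b -> b < 1 -> (weight_integral p mu < +oo)%E.
Proof.
move=> b0 b1; rewrite /weight_integral.
have mw : measurable_fun (disk R : set (borelC R))
    (fun z => (1 / (1 - cabs z) `^ (p / 2))%:E).
  by apply: measurable_funTS; apply/measurable_EFinP; exact: measurable_weight.
rewrite (integral_disk_curve hmu mw) => [|z]; last by rewrite lee_fin weight_ge0.
apply: le_lt_trans (ltry (1 - b)^-1); apply: le_trans (integral_powR_le b0 b1).
apply: ge0_le_integral.
- by [].
- move=> t _; rewrite patchE; case: ifP => // _; exact: weight_ge0.
- apply: measurable_funTS.
  apply: (measurableT_comp _ (measurable_curve a1)).
  by apply/(measurable_restrictT _ (@measurable_disk R)).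
- by apply: measurable_funTS; apply/measurable_EFinP; exact: measurable_powR.
- move=> t; rewrite /= in_itv/= => t01; rewrite patchE; case: ifP => _.
    by rewrite weight_curve.
  by rewrite lee_fin powR_ge0.
Qed.

(** Test [weighted_bound] on the geometric means. On the part t <= 1/(6N) of the
curve, where they are at least 1/2, the weight contributes N^(b-1) up to a
constant, while the bound is a multiple of (1/N)^(1-p/2). Since b > p/2, this
fails for N large. *)
Lemma curve_not_summing (r : R) : 1 <= p -> p < 2 -> p / 2 < b -> 1 <= r ->
  ~ identity_summing p p r mu.
Proof.
move=> p1 p2 pb r1 summ.
have p12 : 1 <= p <= 2 by rewrite p1 ltW.
have [K K0 hK] := weighted_bound p12 p1 r1 summ.
pose c : R := (1 / 2) `^ p * 6 `^ (b - 1).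
have c0 : 0 < c by rewrite mulr_gt0// powR_gt0.
have p0 : 0 < p by lra.
have b0 : 0 < b by lra.
(* The two sides compared, after multiplication by N^(1-p/2). *)
suff H N : (0 < N)%N -> c * N%:R `^ (b - p / 2) <= K.
  pose s := b - p / 2; have s0 : 0 < s by rewrite /s; lra.
  pose x := (K / c + 1) `^ s^-1.
  have kc : 0 <= K / c + 1 by rewrite addr_ge0// divr_ge0// ltW.
  pose N := (Num.truncn x).+1.
  have xN : x <= N%:R by apply/ltW/real_truncnS_gt/num_real.
  have := H N isT; rewrite -/s mulrC -ler_pdivlMr//.
  have : x `^ s <= N%:R `^ s.
    by rewrite ge0_ler_powR ?nnegrE ?powR_ge0// ltW.
  rewrite /x -powRrM mulVf ?gt_eqF// powRr1//; lra.
move=> N0; have Nr0 : 0 < N%:R :> R by rewrite ltr0n.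
(* On ]0, d] the curve is within 3 d = 1/(2N) of 1. *)
pose d : R := (6 * N%:R)^-1.
have d0 : 0 < d by rewrite invr_gt0 mulr_gt0.
have N1 : 1 <= N%:R :> R by rewrite ler1n.
have d1 : d <= 1 by rewrite invf_le1 ?mulr_gt0//; lra.
have h := hK (geometric_mean N) N%:R^-1 (fun z => @derivable_psum R[i] N _ z)
  (@geometric_mean_le1 R N) _ (mean_sqr_geometric_mean N0).
have {h} := h (_ : 0 < N%:R^-1); rewrite invr_gt0 => /(_ Nr0).
pose f (z : borelC R) := (cabs (geometric_mean N z) `^ p * (1 / (1 - cabs z) `^ (p / 2)))%:E.
have f0 z : (0 <= f z)%E by rewrite lee_fin mulr_ge0 ?powR_ge0 ?weight_ge0.
have mf : measurable_fun setT f.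
  apply/measurable_EFinP; apply: measurable_funM; last exact: measurable_weight.
  apply: (@measurableT_comp _ _ _ _ _ _ (fun x : R => x `^ p)) => //.
  apply: continuous_measurable_borelC => z; apply: continuous_comp.
    exact: continuous_psum.
  exact: continuous_cabs.
have mfD : measurable_fun (disk R : set (borelC R)) f by exact: measurable_funTS.
rewrite -/f (integral_disk_curve hmu mfD f0) mulfV ?gt_eqF// powRr1 ?powR_ge0// => h.
have l : ((((1 / 2) `^ p * d `^ (- b)) * d)%:E <=
    \int[lebesgue_measure]_(t in `[0%R, 1%R]) (f \_ (disk R)) (curve a t))%E.
  pose B : set (measurableTypeR R) := [set` `]0, d]].
  have mB : measurable B by exact: measurable_itv.
  apply: (@le_trans _ _ (\int[lebesgue_measure]_(t in `[0%R, 1%R])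
     (((1 / 2) `^ p * d `^ (- b))%:E * (\1_B t)%:E))%E).
    rewrite ge0_integralZl//; first last.
    - by rewrite lee_fin mulr_ge0 ?powR_ge0.
    - by apply: measurable_funTS; apply/measurable_EFinP; exact: measurable_indic.
    rewrite integral_indic//.
    rewrite setIidl; last first.
      move=> t; rewrite /B /= !in_itv/= => /andP[t0 td].
      by rewrite (ltW t0)/= (le_trans td).
    by rewrite /B /= lebesgue_measure_itv/= lte_fin d0 oppr0 adde0 -EFinM.
  apply: ge0_le_integral.
  - by [].
  - by move=> t _; rewrite -EFinM lee_fin !mulr_ge0 ?powR_ge0.
  - apply: emeasurable_funM => //; apply: measurable_funTS.
    by apply/measurable_EFinP; exact: measurable_indic.
  - apply: measurable_funTS.
    apply: (measurableT_comp _ (measurable_curve a1)).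
    by apply/(measurable_restrictT _ (@measurable_disk R)).
  - move=> t; rewrite /= in_itv/= => t01; rewrite -EFinM indicE.
    have [/set_mem|_] := boolP (t \in B); last first.
      by rewrite mulr0 patchE; case: ifP.
    rewrite /B /= in_itv/= mulr1 => /andP[t0 td].
    have cD : disk R (curve a t).
      by rewrite /disk /mkset cabs_curve// ltrBlDr ltrDl powR_gt0.
    rewrite patchE ifT ?inE// lee_fin weight_curve//.
    apply: ler_pM; rewrite ?powR_ge0//.
      rewrite ge0_ler_powR ?nnegrE ?cabs_ge0 ?(ltW p0)//.
      apply: geometric_mean_near1 => //; first exact/ltW.
      apply: (@le_trans _ _ (N%:R * (3 * d))).
        rewrite ler_wpM2l ?(ltW Nr0)//; apply: le_trans (curve_near1 a1 t01) _.
        by rewrite ler_wpM2l.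
      rewrite /d le_eqVlt; apply/orP; left; apply/eqP; field.
      by rewrite gt_eqF.
    rewrite !powRN lef_pV2 ?posrE ?powR_gt0//.
    by rewrite ge0_ler_powR ?nnegrE ?(ltW b0) ?(ltW t0) ?(ltW d0).
move: (le_trans l h); rewrite lee_fin.
have -> : (1 / 2) `^ p * d `^ (- b) * d = c * N%:R `^ (b - 1).
  rewrite /c -!mulrA; congr (_ * _).
  rewrite -[X in _ * X](powRr1 (ltW d0)) -powRD ?(gt_eqF d0) ?implybT//.
  rewrite /d -(powR_inv1 (_ : 0 <= 6 * N%:R)) ?mulr_ge0 ?(ltW Nr0)//.
  by rewrite -powRrM powRM ?(ltW Nr0)//; congr (_ `^ _ * _ `^ _); ring.
rewrite -(powR_inv1 (ltW Nr0)) -powRrM.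
have -> : N%:R `^ (b - 1) = N%:R `^ (b - p / 2) * N%:R `^ (-1 * (1 - p / 2)).
  by rewrite -powRD ?(gt_eqF Nr0) ?implybT//; congr (_ `^ _); ring.
by rewrite mulrA ler_pM2r// powR_gt0.
Qed.

End counterexample.

Section necessary_condition.
Context (R : realType).

(** [weighted_bound] for the multiplier 1, whose mean squares are 1. *)
Lemma summing_weight_integral (p q r : R) (mu : {measure set (borelC R) -> \bar R}) :
  1 <= p <= 2 -> 1 <= q -> 1 <= r -> identity_summing p q r mu ->
  (weight_integral q mu < +oo)%E.
Proof.
move=> p12 q1 r1 summ; have [K _ hK] := weighted_bound p12 q1 r1 summ.
pose one : cplx R -> cplx R := cst 1.
have one1 z : cabs (one z) = 1 by exact: Normc.normc1.
have ms : mean_sqr_le one 1.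
  move=> s _; rewrite (eq_integral (cst 1%E)) => [|t _]; last by rewrite one1 expr1n.
  rewrite integral_cst//= lebesgue_measure_itv/= lte_fin mulr_gt0 ?pi_gt0//.
  by rewrite oppr0 adde0 mul1e mulr1.
have one_le z : disk R z -> cabs (one z) <= 1 by rewrite one1.
have h := hK one 1 (fun z => derivable_cst _ _ _) one_le ltr01 ms.
apply: le_lt_trans (ltry (K * (1 `^ (1 - p / 2)) `^ (q / p))).
apply: le_trans h; rewrite le_eqVlt; apply/orP; left; apply/eqP.
by apply: eq_integral => z _; rewrite one1 powR1 !mul1r.
Qed.

End necessary_condition.

Theorem proposition1p4 (R : realType) (p : R) (hp1 : 1 <= p) (hp2 : p <= 2) :
  (forall (q : R), 1 <= q -> q <= 2 ->
     forall mu : {measure set (borelC R) -> \bar R}, on_disk mu ->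
     (exists2 r : R, 1 <= r & identity_summing p q r mu) ->
     (weight_integral q mu < +oo)%E) /\
  (forall mu : {measure set (borelC R) -> \bar R}, on_disk mu ->
     (exists2 r : R, 1 <= r & identity_summing p p r mu) ->
     (weight_integral p mu < +oo)%E) /\
  (p < 2 ->
     exists mu : {measure set (borelC R) -> \bar R},
       [/\ on_disk mu, carleson mu, (weight_integral p mu < +oo)%E &
           forall r : R, 1 <= r -> ~ identity_summing p p r mu]).
Proof.
have p12 : 1 <= p <= 2 by rewrite hp1 hp2.
split; last split.
- move=> q q1 _ mu _ [r r1 summ]; exact: summing_weight_integral p12 q1 r1 summ.
- move=> mu _ [r r1 summ]; exact: summing_weight_integral p12 hp1 r1 summ.
move=> p2; have p0 : 0 < p by lra.
(* The midpoint of the admissible range 1 < a < 2/p. *)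
pose a : R := (1 + 2 / p) / 2.
have ab : a * (p / 2) = p / 4 + 1 / 2 by rewrite /a; field; rewrite gt_eqF.
have a1 : 1 <= a.
  suff : 1 <= 2 / p by rewrite /a; lra.
  by rewrite ler_pdivlMr// mul1r.
have [mu hmu] := curve_measure a1; exists mu; split.
- exact: curve_measure_on_disk hmu.
- exact: curve_measure_carleson hmu.
- by apply: (curve_weight_integral a1 hmu); rewrite ab; lra.
- by move=> r r1; apply: (curve_not_summing a1 hmu) => //; rewrite ab; lra.
Qed.
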